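(* Assume the regularity conditions (i) and (ii) of the context, and use the notation of the context. Then the gradient flow of the free energy functional $\tilde{\mathcal F}$ with respect to $W_J$ is given by $$\partial_tu_t=-\operatorname{grad}_{W_J}\tilde{\mathcal F}_t(u_t)=\operatorname{div}\Big(J\,u_t\,\nabla\big(\ln u_t+\beta m\,h_{f_t}(\Phi_t(\tilde z))\big)\Big)=-\mathcal J(u_t)\big(\ln u_t+\beta m\,h_{f_t}(\Phi_t(\tilde z))\big).$$
   Context: Fix $d\ge1$, $T\in(0,\infty)$ and positive constants $m,\gamma,\beta$; put $\sigma=\sqrt{2\gamma/(\beta m^2)}$. Points of $\mathbb{R}^{2d}=\mathbb{R}^d\times\mathbb{R}^d$ are written $z=(x,v)^\top$. $(B_t)_{t\ge0}$ is a standard $d$-dimensional Brownian motion on a probability space $(\Omega,\mathcal G,\mathbb P)$ with normal filtration $(\mathcal G_t)_{t\ge0}$, and $\mathbb E$ is expectation under $\mathbb P$. Regularity conditions. (i) $U,K:\mathbb{R}^d\to[0,\infty)$ are smooth, $K$ is symmetric, $U(x)\ge\kappa_U|x|^2$ for all $x$ and some $\kappa_U>0$, $\nabla U$ and $\nabla K$ are Lipschitz, and for every $j\ge2$ there is a constant $C_j$ with $|\nabla^jU|\le C_j$, $|\nabla^jK|\le C_j$. (ii) The law of $(X_0,V_0)$ has density $f_0\in C^\infty(\mathbb{R}^{2d})$ with $\mathbb E[|\nabla_v\ln f_0(X_0,V_0)|^2]<\infty$, $\mathbb E[|X_0|^4+|V_0|^4]<\infty$ and $\mathcal F(f_0)<\infty$,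 where $\mathcal F(f):=\int_{\mathbb{R}^{2d}}(f\ln f+\beta m f\check h_f)\,\mathrm dz$. For a density $f$ on $\mathbb{R}^{2d}$: $K*f(x):=\int_{\mathbb{R}^{2d}}K(x-x')f(x',v')\,\mathrm dx'\mathrm dv'$, $h_f(x,v):=\frac12|v|^2+\frac1mU(x)+\frac1mK*f(x)$ and $\check h_f(x,v):=\frac12|v|^2+\frac1mU(x)+\frac1{2m}K*f(x)$. $(X_t,V_t)_{0\le t\le T}$ is the unique strong solution of the mean-field Langevin equation $$\mathrm dX_t=V_t\,\mathrm dt,\qquad \mathrm dV_t=-\tfrac1m\nabla U(X_t)\,\mathrm dt-\tfrac1m\nabla(K*\rho_t)(X_t)\,\mathrm dt-\tfrac\gamma mV_t\,\mathrm dt+\sigma\,\mathrm dB_t,$$ with $\rho_t=\mathrm{Law}(X_t,V_t)$. Under (i)-(ii), $\rho_t$ has a smooth density $f_t$, strictly positive for $t\in(0,T]$, solving the Vlasov-Fokker-Planck equation $\partial_tf_t+v\cdot\nabla_xf_t-\frac1m\nabla_x(U+K*f_t)\cdot\nabla_vf_t=\frac\gamma m\nabla_v\cdot(vf_t)+\frac{\sigma^2}2\Delta_vf_t$. Set $b_H(z):=\binom{v}{-\frac1m\nabla U(x)-\frac1m\nabla K*f(x)}$, where $f=f_t$ at time $t$, and $G:=\binom{0}{\sigma I_{d\times d}}\in\mathbb{R}^{2d\times d}$. $\Phi_t:\mathbb{R}^{2d}\to\mathbb{R}^{2d}$ is the flow of $b_H$: $\frac{\mathrm d}{\mathrm dt}\Phi_t(z)=b_H(\Phi_t(z))$,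 $\Phi_0(z)=z$; $\Phi_{-t}$ denotes the inverse map of $\Phi_t$, and $D\Phi_{-t}$ its Jacobian matrix. Pulled-back density: $u_t(\tilde z):=f_t(\Phi_t(\tilde z))$. Put (at time $t$) $\tilde G(\tilde z):=D\Phi_{-t}(\Phi_t(\tilde z))G$, $\tilde A:=\tilde G\tilde G^\top$, and $J:=\frac12\tilde A$ (symmetric positive semidefinite). Onsager operator: $\mathcal J(u)\psi:=-\operatorname{div}(J\,u\,\nabla\psi)$ for $\psi\in C^\infty(\mathbb{R}^{2d})$. Free energy functional of the pulled-back system: $\tilde{\mathcal F}_t(u):=\int_{\mathbb{R}^{2d}}\big(u(\tilde z)\ln u(\tilde z)+\beta m\,u(\tilde z)\,\check h_{f_t}(\Phi_t(\tilde z))\big)\mathrm d\tilde z$, where $f_t$ is the density at time $t$ of the solution above. Otto-Onsager metric: for $\xi=-\operatorname{div}(J\mu\nabla\psi)$ put $\|\xi\|^2_{J,\mu}:=\int_{\mathbb{R}^{2d}}\langle\nabla\psi,J\nabla\psi\rangle\,\mathrm d\mu$; for probability measures $\mu_0,\mu_1$ on $\mathbb{R}^{2d}$, $$W_J^2(\mu_0,\mu_1):=\inf_{(\mu_t,w_t)}\Big\{\int_0^1\Big\|\frac{\partial\mu_t}{\partial t}\Big\|^2_{J,\mu_t}\mathrm dt\ :\ \partial_t\mu_t+\operatorname{div}(Jw_t\mu_t)=0\text{ in the distributional sense}\Big\}.$$ The $W_J$-gradient is expressed, with $\frac{\delta}{\delta u}$ the first variation, in the form $$\operatorname{grad}_{W_J}\tilde{\mathcal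 F}_t(u)=-\operatorname{div}\Big(J\,u\,\nabla\frac{\delta\tilde{\mathcal F}_t(u)}{\delta u}\Big).$$ *)

(* Defs.v *)
From HB Require Import structures.
From mathcomp Require Import all_boot all_order all_algebra.
From mathcomp Require Import all_classical all_reals all_analysis.
Set Implicit Arguments.
Unset Strict Implicit.
Unset Printing Implicit Defensive.
Import Order.TTheory GRing.Theory Num.Theory.
Import numFieldNormedType.Exports.
Local Open Scope classical_set_scope.
Local Open Scope ring_scope.

(* Points of R^n are row vectors 'rV[R]_n; a point (x, v) of R^2d is
   row_mx x v : 'rV[R]_(d + d), so x = lsubmx z and v = rsubmx z. *)

Fact measure_rV_display : measure_display.
Proof. exact: default_measure_display. Qed.

(* The Borel sigma-algebra of R^n, generated by the coordinate maps. *)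
Section measurable_rV.
Context (R : realType) (n : nat).

Let coors : 'I_n -> 'rV[R]_n -> R := fun i z => z 0 i.

Let rV_set0 : g_sigma_preimage coors set0.
Proof. exact: sigma_algebra0. Qed.

Let rV_setC A : g_sigma_preimage coors A -> g_sigma_preimage coors (~` A).
Proof. exact: sigma_algebraC. Qed.

Let rV_bigcup (F : (set 'rV[R]_n)^nat) :
  (forall i, g_sigma_preimage coors (F i)) ->
  g_sigma_preimage coors (\bigcup_i (F i)).
Proof. exact: sigma_algebra_bigcup. Qed.

HB.instance Definition _ := @isMeasurable.Build measure_rV_display
  'rV[R]_n (g_sigma_preimage coors) rV_set0 rV_setC rV_bigcup.

End measurable_rV.

Definition consrV (R : realType) n (p : measurableTypeR R * 'rV[R]_n) :
    'rV[R]_n.+1 :=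
  row_mx p.1%:M p.2.

(* Lebesgue measure on R^n, built as an n-fold product measure. *)
Fixpoint lebesgue_rV (R : realType) (n : nat) : set 'rV[R]_n -> \bar R :=
  match n return set 'rV[R]_n -> \bar R with
  | 0 => dirac (0 : 'rV[R]_0)
  | n'.+1 =>
      pushforward (lebesgue_measure \x @lebesgue_rV R n')%E (@consrV R n')
  end.
Arguments lebesgue_rV {R n}.

Section lebesgue_rV_measure.
Context {R : realType}.

Lemma measurable_coord n (i : 'I_n) :
  measurable_fun [set: 'rV[R]_n] (fun z => z 0 i).
Proof.
move=> _ Y mY; rewrite setTI; apply: sub_sigma_algebra => /=.
rewrite -bigcup_seq/=; exists i => /=; first by rewrite mem_index_enum.
by exists Y => //; rewrite setTI.
Qed.

Lemma measurable_fun_coordP d (T : measurableType d) n (f : T -> 'rV[R]_n) :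
  (forall i, measurable_fun [set: T] (fun x => f x 0 i)) ->
  measurable_fun [set: T] f.
Proof.
move=> mf _ A mA; rewrite setTI.
pose C := [set B : set 'rV[R]_n | measurable (f @^-1` B)].
suff : (measurable : set (set 'rV[R]_n)) `<=` C by move=> /(_ A mA).
apply: smallest_sub.
  split; first by rewrite /C/= preimage_set0.
    by move=> B mB; rewrite /C/= setTD preimage_setC; exact: measurableC.
  by move=> F mF; rewrite /C/= preimage_bigcup; exact: bigcupT_measurable.
move=> B; rewrite -bigcup_seq => -[i _ [Y mY <-]].
by rewrite /C/= setTI -[X in measurable X]setTI; exact: mf.
Qed.

Lemma consrV0 n (p : measurableTypeR R * 'rV[R]_n) : consrV p 0 ord0 = p.1.
Proof.
have := row_mxEl (scalar_mx p.1 : 'M[R]_1) p.2 0 (ord0 : 'I_1).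
rewrite [RHS]mxE eqxx mulr1n => <-; rewrite /consrV.
by congr (row_mx _ _ _ _); exact: val_inj.
Qed.

Lemma consrVS n (p : measurableTypeR R * 'rV[R]_n) i : consrV p 0 (lift ord0 i) = p.2 0 i.
Proof.
have := row_mxEr (scalar_mx p.1 : 'M[R]_1) p.2 0 i => <-; rewrite /consrV.
by congr (row_mx _ _ _ _); exact: val_inj.
Qed.

Lemma measurable_consrV n : measurable_fun setT (@consrV R n).
Proof.
apply: measurable_fun_coordP => i; have [j ->|->] := unliftP ord0 i.
  under eq_fun do rewrite consrVS.
  by apply: (measurableT_comp (@measurable_coord n j)).
under eq_fun do rewrite consrV0; exact: measurable_fst.
Qed.

Lemma lebesgue_rV_sigma_finite_measure n :
  exists mu : {sigma_finite_measure set 'rV[R]_n -> \bar R},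
    lebesgue_rV = mu.
Proof.
elim: n => [|n [mu IH]] /=.
  by exists (dirac (0 : 'rV[R]_0)).
rewrite IH.
pose m1 : {sigma_finite_measure set (measurableTypeR R) -> \bar R} :=
  lebesgue_measure.
pose m : {measure set _ -> \bar R} := (m1 \x mu)%E.
have [F FT Foo] : sigma_finite setT m.
  have /sigma_finiteP[F [TF ndF Foo]] := sigma_finiteT m1.
  have /sigma_finiteP[G [TG ndG Goo]] := sigma_finiteT mu.
  exists (fun n => F n `*` G n) => [|k].
    rewrite -setXTT TF TG predeqE => -[x y]; split.
      move=> [/= [i _ Fx] [j _ Gy]]; exists (maxn i j) => //; split.
      - by move: x Fx; exact/subsetPset/ndF/leq_maxl.
      - by move: y Gy; exact/subsetPset/ndG/leq_maxr.
    by move=> [i _ []/= ? ?]; split; exists i.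
  have [? ?] := Foo k; have [? ?] := Goo k.
  split; first exact: measurableX.
  by rewrite /m/= product_measure1E// lte_mul_pinfty// ge0_fin_numE.
have mm := @measurable_consrV n.
pose uncons (z : 'rV[R]_n.+1) : measurableTypeR R * 'rV[R]_n :=
  (z 0 ord0, \row_i z 0 (lift ord0 i)).
have consK : cancel (@consrV R n) uncons.
  by move=> [a z]; rewrite /uncons consrV0; congr pair;
    apply/rowP => i; rewrite mxE consrVS.
have munc : measurable_fun setT uncons.
  apply: measurable_fun_pair => /=; first exact: measurable_coord.
  by apply: measurable_fun_coordP => i; under eq_fun do rewrite mxE;
    exact: measurable_coord.
have sf : sigma_finite setT (pushforward m (@consrV R n)).
  exists (fun k => uncons @^-1` F k) => [|k].
    by rewrite -preimage_bigcup -FT preimage_setT.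
  have [mFk Fkoo] := Foo k; split.
    by rewrite -[X in measurable X]setTI; exact: munc.
  rewrite /pushforward -comp_preimage (_ : _ \o _ = id) ?preimage_id//.
  by apply/funext => p /=; rewrite consK.
pose nu0 : {measure set 'rV[R]_n.+1 -> \bar R} :=
  pushforward m (@consrV R n).
pose nu := nu0 mm.
pose H := Measure_isSigmaFinite.Build _ _ _ nu sf.
pose nu' : {sigma_finite_measure set 'rV[R]_n.+1 -> \bar R} :=
  HB.pack (Measure.sort nu) H.
by exists nu'.
Qed.

Context {n : nat}.
Local Notation lam := (@lebesgue_rV R n).

Let lebesgue_rV0 : lam set0 = 0%E.
Proof. by have [mu ->] := lebesgue_rV_sigma_finite_measure n. Qed.

Let lebesgue_rV_ge0 A : (0 <= lam A)%E.
Proof. by have [mu ->] := lebesgue_rV_sigma_finite_measure n. Qed.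

Let lebesgue_rV_sigma_additive : semi_sigma_additive lam.
Proof.
have [mu ->] := lebesgue_rV_sigma_finite_measure n.
exact: measure_semi_sigma_additive.
Qed.

HB.instance Definition _ := isMeasure.Build _ _ _ lam
  lebesgue_rV0 lebesgue_rV_ge0 lebesgue_rV_sigma_additive.

Let lebesgue_rV_sigma_finite : sigma_finite setT lam.
Proof.
have [mu ->] := lebesgue_rV_sigma_finite_measure n; exact: sigma_finiteT.
Qed.

HB.instance Definition _ := Measure_isSigmaFinite.Build _ _ _ lam
  lebesgue_rV_sigma_finite.

End lebesgue_rV_measure.

Section euclidean_calculus.
Context {R : realType}.

Definition dotv n (a b : 'rV[R]_n) : R := \sum_i a 0 i * b 0 i.

(* The library norm on matrices is the sup norm. *)
Definition enorm n (a : 'rV[R]_n) : R := Num.sqrt (dotv a a).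

Definition partial n (i : 'I_n) (g : 'rV[R]_n -> R) (z : 'rV[R]_n) : R :=
  'D_(delta_mx 0 i) g z.

Definition partials n (s : seq 'I_n) (g : 'rV[R]_n -> R) : 'rV[R]_n -> R :=
  foldr (@partial n) g s.

Definition smooth n (g : 'rV[R]_n -> R) : Prop :=
  forall (s : seq 'I_n) z, differentiable (partials s g) z.

Definition smooth_map n k (F : 'rV[R]_n -> 'rV[R]_k) : Prop :=
  forall j, smooth (fun z => F z 0 j).

Definition test_function n (g : 'rV[R]_n -> R) : Prop :=
  smooth g /\ exists r : R, forall z, r < enorm z -> g z = 0.

Definition grad n (g : 'rV[R]_n -> R) (z : 'rV[R]_n) : 'rV[R]_n :=
  \row_i partial i g z.

Definition div n (F : 'rV[R]_n -> 'rV[R]_n) (z : 'rV[R]_n) : R :=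
  \sum_i partial i (fun y => F y 0 i) z.

(* |nabla^j g|, the Frobenius norm of the tensor of j-th derivatives. *)
Definition tensor_norm n (j : nat) (g : 'rV[R]_n -> R) (z : 'rV[R]_n) : R :=
  Num.sqrt (\sum_(s : j.-tuple 'I_n) partials s g z ^+ 2).

(* 'J F z acts on row vectors from the right; its transpose is the usual
   Jacobian matrix, with (i, j) entry the j-th partial derivative of F_i. *)
Definition Dmx n k (F : 'rV[R]_n -> 'rV[R]_k) (z : 'rV[R]_n) : 'M[R]_(k, n) :=
  ('J F z)^T.

Definition mxact k n (A : 'M[R]_(k, n)) (w : 'rV[R]_n) : 'rV[R]_k :=
  (A *m w^T)^T.

Definition gradx d (g : 'rV[R]_(d + d) -> R) z : 'rV[R]_d := lsubmx (grad g z).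
Definition gradv d (g : 'rV[R]_(d + d) -> R) z : 'rV[R]_d := rsubmx (grad g z).

Definition divv d (F : 'rV[R]_(d + d) -> 'rV[R]_d) (z : 'rV[R]_(d + d)) : R :=
  \sum_i partial (rshift d i) (fun y => F y 0 i) z.

Definition laplacev d (g : 'rV[R]_(d + d) -> R) : 'rV[R]_(d + d) -> R :=
  divv (gradv g).

(* g has time derivative l at t relative to [0, T]; this is the one-sided
   derivative at the end points. *)
Definition has_dt (W : normedModType R) (T : R) (g : R -> W) (t : R) (l : W)
    : Prop :=
  (fun s => (s - t)^-1 *: (g s - g t)) @ within `[0, T] t^' --> l.

End euclidean_calculus.

Section langevin.
Context {R : realType} {d : nat}.
Implicit Types (U K : 'rV[R]_d -> R) (f u : 'rV[R]_(d + d) -> R).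
Local Notation phase := 'rV[R]_(d + d).

Definition lipschitz_grad (g : 'rV[R]_d -> R) : Prop :=
  exists L : R, forall x y, enorm (grad g x - grad g y) <= L * enorm (x - y).

Definition bounded_higher_derivatives (g : 'rV[R]_d -> R) : Prop :=
  forall j, (2 <= j)%N -> exists C : R, forall x, tensor_norm j g x <= C.

Record regular_potentials U K : Prop := {
  U_ge0 : forall x, 0 <= U x;
  K_ge0 : forall x, 0 <= K x;
  U_smooth : smooth U;
  K_smooth : smooth K;
  K_sym : forall x, K (- x) = K x;
  U_growth : exists2 kappa : R, 0 < kappa &
    forall x, kappa * enorm x ^+ 2 <= U x;
  gradU_lipschitz : lipschitz_grad U;
  gradK_lipschitz : lipschitz_grad K;
  U_bounded : bounded_higher_derivatives U;
  K_bounded : bounded_higher_derivatives K }.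

(* K * f for a density f and K * rho for a law rho on R^2d. *)
Definition conv (k : 'rV[R]_d -> R) f (x : 'rV[R]_d) : R :=
  \int[lebesgue_rV]_z (k (x - lsubmx z) * f z).

Definition conv_law (k : 'rV[R]_d -> R) (rho : set phase -> \bar R)
    (x : 'rV[R]_d) : R :=
  fine (\int[rho]_z (k (x - lsubmx z))%:E)%E.

Definition hfun (m : R) U K f (z : phase) : R :=
  2^-1 * enorm (rsubmx z) ^+ 2 + m^-1 * U (lsubmx z)
  + m^-1 * conv K f (lsubmx z).

Definition hcheck (m : R) U K f (z : phase) : R :=
  2^-1 * enorm (rsubmx z) ^+ 2 + m^-1 * U (lsubmx z)
  + (2 * m)^-1 * conv K f (lsubmx z).

Definition free_energy (m beta : R) U K f : \bar R :=
  \int[lebesgue_rV]_z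
    (f z * ln (f z) + beta * m * (f z * hcheck m U K f z))%:E.

Definition sigma (m gamma beta : R) : R :=
  Num.sqrt (2 * gamma / (beta * m ^+ 2)).

Definition VFP (m gamma beta : R) U K (T : R) (f : R -> phase -> R) : Prop :=
  forall t z, 0 < t <= T ->
  has_dt T (fun s => f s z : R^o) t
    (- dotv (rsubmx z) (gradx (f t) z)
     + m^-1 * dotv (grad (fun x => U x + conv K (f t) x) (lsubmx z))
                   (gradv (f t) z)
     + gamma / m * divv (fun y => f t y *: rsubmx y) z
     + sigma m gamma beta ^+ 2 / 2 * laplacev (f t) z).

Definition bH (m : R) U K f (z : phase) : phase :=
  row_mx (rsubmx z)
    (- (m^-1 *: grad U (lsubmx z))
     - m^-1 *: (\row_i conv (partial i K) f (lsubmx z))).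

Definition Gmx (m gamma beta : R) : 'M[R]_(d + d, d) :=
  col_mx 0 (sigma m gamma beta)%:M.

(* Phi t is the flow of the (time-dependent) smooth field b, a smooth
   diffeomorphism of R^n, and Phiinv t = Phi_{-t} is its inverse map. *)
Record is_flow n (T : R) (b : R -> 'rV[R]_n -> 'rV[R]_n)
    (Phi Phiinv : R -> 'rV[R]_n -> 'rV[R]_n) : Prop := {
  flow0 : forall z, Phi 0 z = z;
  flow_ode : forall t z, 0 <= t <= T ->
    has_dt T (fun s => Phi s z) t (b t (Phi t z));
  flowK : forall t, 0 <= t <= T -> cancel (Phi t) (Phiinv t);
  flowVK : forall t, 0 <= t <= T -> cancel (Phiinv t) (Phi t);
  flow_smooth : forall t, 0 <= t <= T -> smooth_map (Phi t);
  flowV_smooth : forall t, 0 <= t <= T -> smooth_map (Phiinv t) }.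

Definition pullback (f : R -> phase -> R) (Phi : R -> phase -> phase)
    (t : R) : phase -> R :=
  f t \o Phi t.

Definition Jmx (m gamma beta : R) (Phi Phiinv : R -> phase -> phase)
    (t : R) (z : phase) : 'M[R]_(d + d) :=
  let Gt := Dmx (Phiinv t) (Phi t z) *m Gmx m gamma beta in
  2^-1 *: (Gt *m Gt^T).

Definition free_energy_pb (m beta : R) U K (f : R -> phase -> R)
    (Phi : R -> phase -> phase) (t : R) u : \bar R :=
  \int[lebesgue_rV]_z
    (u z * ln (u z) + beta * m * (u z * hcheck m U K (f t) (Phi t z)))%:E.

End langevin.

Section gradient_flow.
Context {R : realType} {n : nat}.
Implicit Types (u psi chi : 'rV[R]_n -> R) (F : ('rV[R]_n -> R) -> \bar R).

Definition onsager (J : 'rV[R]_n -> 'M[R]_n) u psi (z : 'rV[R]_n) : R :=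
  - div (fun y => u y *: mxact (J y) (grad psi y)) z.

(* psi = dF/du: the perturbations chi have zero mass, so that u + eps chi is
   still a density, and psi is determined up to an additive constant. *)
Definition first_variation F u psi : Prop :=
  forall chi, test_function chi -> \int[lebesgue_rV]_z chi z = 0 ->
    (\forall e \near (0 : R), F (fun z => u z + e * chi z) \is a fin_num) /\
    is_derive (0 : R) (1 : R) (fun e => fine (F (fun z => u z + e * chi z)))
      (\int[lebesgue_rV]_z (psi z * chi z)).

(* g = grad_{W_J} F (u) = - div (J u nabla (dF/du)). *)
Definition is_WJ_gradient (J : 'rV[R]_n -> 'M[R]_n) F u (g : 'rV[R]_n -> R)
    : Prop :=
  exists psi, [/\ smooth psi, first_variation F u psi &
    forall z, g z = - div (fun y => u y *: mxact (J y) (grad psi y)) z].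

End gradient_flow.

Section probability.
Context {R : realType} {dO : measure_display} {Om : measurableType dO}.
Variable P : probability Om R.
Implicit Types (Fi : R -> set (set Om)).

(* Indexed by the reals, only the times t >= 0 matter. *)
Record normal_filtration Fi : Prop := {
  filt_sigma : forall t, 0 <= t -> sigma_algebra setT (Fi t);
  filt_measurable : forall t, 0 <= t -> Fi t `<=` measurable;
  filt_mono : forall s t, 0 <= s -> s <= t -> Fi s `<=` Fi t;
  filt_right : forall t, 0 <= t -> \bigcap_(s in [set s | t < s]) Fi s = Fi t;
  filt_null : forall A, measurable A -> P A = 0%E -> Fi 0 A }.

Definition adapted d Fi (T : set R) (Y : R -> Om -> 'rV[R]_d) : Prop :=
  forall t, T t -> forall (i : 'I_d) (C : set R), measurable C ->
    Fi t [set w | C (Y t w 0 i)].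

(* The last clause says that B t - B s is independent of Fi s, with
   independent coordinates of law N(0, t - s). *)
Record brownian d Fi (B : R -> Om -> 'rV[R]_d) : Prop := {
  bm_adapted : adapted Fi `[0, +oo[ B;
  bm0 : {ae P, forall w, B 0 w = 0};
  bm_continuous :
    {ae P, forall w, {within `[0, +oo[, continuous (fun t => B t w)}};
  bm_increments : forall s t, 0 <= s -> s < t ->
    forall (A : set Om) (C : 'I_d -> set R), Fi s A ->
    (forall i, measurable (C i)) ->
    P (A `&` [set w | forall i, C i ((B t w - B s w) 0 i)]) =
    (P A * \prod_(i < d) normal_prob 0 (Num.sqrt (t - s)) (C i))%E }.

Definition phase_process d (X V : R -> Om -> 'rV[R]_d) (t : R) (w : Om)
    : 'rV[R]_(d + d) := row_mx (X t w) (V t w).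

(* As the noise is additive, the integrated equation needs no stochastic
   integral. The second-moment bound is part of the notion of solution: it
   makes K * rho_t well defined, K having at most quadratic growth. *)
Record langevin_solution d (m gamma beta : R) (U K : 'rV[R]_d -> R) (T : R)
    Fi (B X V : R -> Om -> 'rV[R]_d) : Prop := {
  sol_adaptedX : adapted Fi `[0, T] X;
  sol_adaptedV : adapted Fi `[0, T] V;
  sol_moment : exists C : R, forall t, 0 <= t <= T ->
    (\int[P]_w (enorm (X t w) ^+ 2 + enorm (V t w) ^+ 2)%:E <= C%:E)%E;
  sol_continuous :
    {ae P, forall w, {within `[0, T], continuous (fun t => X t w)} /\
                     {within `[0, T], continuous (fun t => V t w)}};
  sol_X : {ae P, forall w, forall t, 0 <= t <= T -> forall i,
    X t w 0 i = X 0 w 0 i + \int[lebesgue_measure]_(s in `[0, t]) V s w 0 i};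
  sol_V : {ae P, forall w, forall t, 0 <= t <= T -> forall i,
    V t w 0 i = V 0 w 0 i
      + \int[lebesgue_measure]_(s in `[0, t])
          (- (m^-1 * partial i U (X s w))
           - m^-1 * partial i
               (conv_law K (pushforward P (phase_process X V s))) (X s w)
           - gamma / m * V s w 0 i)
      + sigma m gamma beta * B t w 0 i } }.

(* f t is the density of Law (X_t, V_t): smooth in z, positive for t > 0, with
   all z-derivatives jointly continuous on (0, T] x R^2d. *)
Record smooth_density d (T : R) (X V : R -> Om -> 'rV[R]_d)
    (f : R -> 'rV[R]_(d + d) -> R) : Prop := {
  dens_ge0 : forall t z, 0 <= t <= T -> 0 <= f t z;
  dens_law : forall t, 0 <= t <= T -> forall A, measurable A ->
    pushforward P (phase_process X V t) A =
    (\int[lebesgue_rV]_(z in A) (f t z)%:E)%E;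
  dens_smooth : forall t, 0 <= t <= T -> smooth (f t);
  dens_gt0 : forall t z, 0 < t <= T -> 0 < f t z;
  dens_continuous : forall s : seq 'I_(d + d),
    {within [set p : R * 'rV[R]_(d + d) | 0 < p.1 <= T],
      continuous (fun p => partials s (f p.1) p.2)} }.

Record regular_initial d (m beta : R) (U K : 'rV[R]_d -> R)
    (X V : R -> Om -> 'rV[R]_d) (f0 : 'rV[R]_(d + d) -> R) : Prop := {
  init_ge0 : forall z, 0 <= f0 z;
  init_law : forall A, measurable A ->
    pushforward P (phase_process X V 0) A =
    (\int[lebesgue_rV]_(z in A) (f0 z)%:E)%E;
  init_smooth : smooth f0;
  init_fisher : (\int[P]_w
    (enorm (gradv (fun z => ln (f0 z)) (phase_process X V 0 w)) ^+ 2)%:E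
    < +oo)%E;
  init_moment :
    (\int[P]_w (enorm (X 0 w) ^+ 4 + enorm (V 0 w) ^+ 4)%:E < +oo)%E;
  init_energy : (free_energy m beta U K f0 < +oo)%E }.

End probability.

(* Main.v *)
Require Import Defs.
From HB Require Import structures.
From mathcomp Require Import all_boot all_order all_algebra.
From mathcomp Require Import all_classical all_reals all_analysis.
From mathcomp Require Import measurable_realfun ring lra.
Set Implicit Arguments.
Unset Strict Implicit.
Unset Printing Implicit Defensive.
Import Order.TTheory GRing.Theory Num.Theory.
Import numFieldNormedType.Exports.
Local Open Scope classical_set_scope.
Local Open Scope ring_scope.

(** In the functional [free_energy_pb] the field [K * f_t] is frozen, so its
    first variation is [ln u + 1 + beta m hcheck(Phi_t)] and not
    [ln u + beta m h(Phi_t)]. The difference is a constant plus a function of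
    the position [x] composed with [Phi_t], and [J] annihilates the gradient of
    the latter: [D Phi_{-t} (Phi_t) D Phi_t = 1], so [J grad (g o Phi_t)] only
    sees the velocity derivatives of [g].

    For the evolution equation, [d/dt f_t (Phi_t z)] is the right-hand side of
    the Vlasov-Fokker-Planck equation plus [b_H . grad f_t]; the transport terms
    cancel and [div_v Y] remains, [Y = sigma^2/2 (grad_v f + beta m v f)],
    evaluated at [Phi_t z]. On the other side the pulled-back flux is
    [D Phi_{-t} (Phi_t) (0, Y (Phi_t))], and its divergence is
    [(div_v Y) (Phi_t)] because [Phi_t] is symplectic: the entries of the
    inverse Jacobian are, up to sign, entries of the Jacobian, and the Piola
    identity becomes the symmetry of second derivatives. Symplecticity is proved
    without differentiating [D Phi_t] in time: for the increments [p, q] of the flow in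
    two directions of size [h], the time derivative of [omega (p, q)] is
    [O (h^3)] by Taylor's formula, since the Hessian of the potential is
    symmetric, while [p, q = O (h)] by Gronwall's lemma. *)

Local Notation conv := Defs.conv.

(** * Calculus on row vectors *)

Section partial_derivatives.
Context {R : realType}.
Implicit Types n k : nat.

Lemma derive_partials n (g : 'rV[R]_n -> R) (z v : 'rV[R]_n) :
  differentiable g z -> 'D_v g z = \sum_i v 0 i * partial i g z.
Proof.
move=> dg; rewrite deriveE// [in LHS](row_sum_delta v) linear_sum.
by apply: eq_bigr => i _; rewrite linearZ /partial deriveE.
Qed.

Lemma differentiable_rVP n k (F : 'rV[R]_n -> 'rV[R]_k) z :
  (forall j, differentiable (fun y => F y 0 j) z) -> differentiable F z.
Proof.
move=> dF; have -> : F = \sum_(j < k) (fun y => F y 0 j *: delta_mx 0 j).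
  by apply/funext => y; rewrite fct_sumE; exact: row_sum_delta.
by apply: differentiable_sum => j; exact: differentiableZl.
Qed.

Lemma derive_rV n k (F : 'rV[R]_n -> 'rV[R]_k) z v j :
  differentiable F z -> ('D_v F z) 0 j = 'D_v (fun y => F y 0 j) z.
Proof. by move=> dF; rewrite derive_mx ?mxE//; exact: diff_derivable. Qed.

Lemma partial_comp n k (F : 'rV[R]_n -> 'rV[R]_k) (g : 'rV[R]_k -> R) z i :
  (forall j, differentiable (fun y => F y 0 j) z) -> differentiable g (F z) ->
  partial i (g \o F) z =
    \sum_j partial j g (F z) * partial i (fun y => F y 0 j) z.
Proof.
move=> dFj dg; have dF := differentiable_rVP dFj.
rewrite /partial deriveE; last exact: differentiable_comp.
rewrite diff_comp//= -deriveE// -deriveE// derive_partials//.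
by apply: eq_bigr => j _; rewrite derive_rV// mulrC.
Qed.

Lemma partial_cst n (c : R) (i : 'I_n) z : partial i (fun=> c) z = 0.
Proof. exact: derive_cst. Qed.

Lemma partialD n (g h : 'rV[R]_n -> R) z i :
  differentiable g z -> differentiable h z ->
  partial i (fun y => g y + h y) z = partial i g z + partial i h z.
Proof.
by move=> dg dh; apply: (deriveD (f := g) (g := h)); exact: diff_derivable.
Qed.

Lemma partialN n (g : 'rV[R]_n -> R) z i : differentiable g z ->
  partial i (fun y => - g y) z = - partial i g z.
Proof. by move=> dg; apply: (deriveN (f := g)); exact: diff_derivable. Qed.

Lemma partialM n (g h : 'rV[R]_n -> R) z i :
  differentiable g z -> differentiable h z ->
  partial i (fun y => g y * h y) z = g z * partial i h z + h z * partial i g z.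
Proof.
by move=> dg dh; apply: (deriveM (f := g) (g := h)); exact: diff_derivable.
Qed.

Lemma partialZ n (c : R) (g : 'rV[R]_n -> R) z i : differentiable g z ->
  partial i (fun y => c * g y) z = c * partial i g z.
Proof. by move=> dg; apply: (deriveZ (f := g)); exact: diff_derivable. Qed.

Lemma differentiable_sumr n (I : Type) (r : seq I) (h : I -> 'rV[R]_n -> R) z :
  (forall j, differentiable (h j) z) ->
  differentiable (fun y => \sum_(j <- r) h j y) z.
Proof.
move=> dh; elim: r => [|j r IH].
  by under eq_fun do rewrite big_nil; exact: differentiable_cst.
by under eq_fun do rewrite big_cons; exact: (differentiableD (dh j) IH).
Qed.

Lemma partial_sumr n (I : Type) (r : seq I) (h : I -> 'rV[R]_n -> R) z i :
  (forall j, differentiable (h j) z) ->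
  partial i (fun y => \sum_(j <- r) h j y) z = \sum_(j <- r) partial i (h j) z.
Proof.
move=> dh; elim: r => [|j r IH].
  by under eq_fun do rewrite big_nil; rewrite partial_cst big_nil.
under eq_fun do rewrite big_cons; rewrite partialD ?IH ?big_cons//.
exact: differentiable_sumr.
Qed.

Lemma partial_coord n (i j : 'I_n) (z : 'rV[R]_n) :
  partial i (fun y => y 0 j) z = (i == j)%:R.
Proof.
rewrite /partial -(@derive_rV n n id) ?derive_id; last first.
  exact: differentiable_rVP (fun j => differentiable_coord _ _ _).
by rewrite mxE eqxx eq_sym.
Qed.

Lemma differentiable_comp1 n (phi : R -> R) (g : 'rV[R]_n -> R) z :
  derivable phi (g z) 1 -> differentiable g z ->
  differentiable (phi \o g) z.
Proof. by move=> /derivable1_diffP dp dg; exact: differentiable_comp. Qed.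

Lemma partial_comp1 n (phi : R -> R) (g : 'rV[R]_n -> R) z i (l : R) :
  is_derive (g z) 1 phi l -> differentiable g z ->
  partial i (phi \o g) z = l * partial i g z.
Proof.
move=> dp dg; have dp' : differentiable phi (g z).
  by apply/derivable1_diffP; exact: ex_derive.
rewrite /partial deriveE; last exact: differentiable_comp.
rewrite diff_comp// diff1E//= derive1E derive_val -deriveE//.
exact: mulrC.
Qed.

Lemma is_derive_line n (g : 'rV[R]_n -> R) z v (s : R) :
  differentiable g (z + s *: v) ->
  is_derive s 1 (fun s => g (z + s *: v))
    (\sum_i v 0 i * partial i g (z + s *: v)).
Proof.
move=> dg; rewrite -derive_partials//.
have dl : is_diff s (fun s : R => z + s *: v) ( *:%R ^~ v).
  have := is_diffD (is_diff_cst z s) (is_diff_scalel s v).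
  by rewrite add0r.
have dl' := @ex_diff _ _ _ _ _ _ _ dl.
have dc := differentiable_comp dl' dg.
have /derivable1_diffP/derivableP := dc.
by move/is_derive_eq; apply;
  rewrite deriveE// diff_comp//= diff_val scale1r -deriveE.
Qed.

Lemma is_derive_continuous (f : R -> R) (x l : R) :
  is_derive x 1 f l -> {for x, continuous f}.
Proof.
move=> df; apply: differentiable_continuous; apply/derivable1_diffP.
exact: ex_derive.
Qed.

Lemma MVT_line n (g : 'rV[R]_n -> R) z v :
  (forall y, differentiable g y) ->
  exists2 c, c \in `]0, 1[%R &
    g (z + v) - g z = \sum_i v 0 i * partial i g (z + c *: v).
Proof.
move=> dg; have dl s := is_derive_line (dg (z + s *: v)).
have [|c c01] := MVT (@ltr01 R) (fun s _ => dl s).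
  by apply: continuous_subspaceT => x; exact: is_derive_continuous.
by rewrite scale1r scale0r addr0 subr0 mulr1 => ->; exists c.
Qed.

End partial_derivatives.

(** * Differentiability up to a finite order, and smoothness *)

Section smooth_functions.
Context {R : realType}.
Implicit Types n k l : nat.

(** The finite-order version of [smooth]. Closure properties are proved by induction on [l], since
    the product and chain rules consume one order at each differentiation. *)
Definition diffn n l (g : 'rV[R]_n -> R) : Prop :=
  forall s : seq 'I_n, (size s <= l)%N -> forall z, differentiable (partials s
    g) z.

Lemma diffn0 n (g : 'rV[R]_n -> R) :
  (forall z, differentiable g z) -> diffn 0 g.
Proof. by move=> dg [|//] _ z; exact: dg. Qed.

Lemma diffn_differentiable n l (g : 'rV[R]_n -> R) z :
  diffn l g -> differentiable g z.
Proof. by move=> /(_ [::] isT). Qed.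

(** In [partials s g] the last index of [s] acts first, so the innermost derivative is isolated by
    decomposing [s] with [rcons]. *)
Lemma diffnS n l (g : 'rV[R]_n -> R) : diffn l.+1 g <->
  (forall z, differentiable g z) /\ forall i, diffn l (partial i g).
Proof.
split=> [dg|[dg dpg] s].
  split=> [z|i s sl z]; first exact: (dg [::]).
  have := dg (rcons s i); rewrite size_rcons => /(_ sl z).
  by rewrite /partials foldr_rcons.
case/lastP: s => [_|s i]; first exact: dg.
by rewrite size_rcons => sl z; rewrite /partials foldr_rcons; exact: dpg.
Qed.

Lemma diffnW n l (g : 'rV[R]_n -> R) : diffn l.+1 g -> diffn l g.
Proof. by move=> dg s sl; apply: dg; exact: leqW. Qed.

Lemma smoothP n (g : 'rV[R]_n -> R) : smooth g <-> forall l, diffn l g.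
Proof. by split=> [sg l s _ z|sg s z]; [exact: sg|exact: (sg (size s))]. Qed.

Lemma smooth_differentiable n (g : 'rV[R]_n -> R) z :
  smooth g -> differentiable g z.
Proof. by move=> /(_ [::]). Qed.

Lemma smooth_partials n (s : seq 'I_n) (g : 'rV[R]_n -> R) :
  smooth g -> smooth (partials s g).
Proof. by move=> sg s' z; rewrite /partials -foldr_cat; exact: sg. Qed.

Lemma smooth_partial n i (g : 'rV[R]_n -> R) : smooth g -> smooth (partial i g).
Proof. exact: (@smooth_partials n [:: i]). Qed.

Lemma smooth_continuous n (g : 'rV[R]_n -> R) : smooth g -> continuous g.
Proof. by move=> sg z;
  exact/differentiable_continuous/smooth_differentiable. Qed.

Lemma diffn_cst n l (c : R) : diffn l (fun _ : 'rV[R]_n => c).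
Proof.
elim: l c => [c|l IH c]; first by apply: diffn0 => z; exact: differentiable_cst.
apply/diffnS; split=> [z|i]; first exact: differentiable_cst.
by rewrite (_ : partial i _ = fun=> 0)//; apply/funext => z; exact: partial_cst.
Qed.

Lemma diffnD n l (g h : 'rV[R]_n -> R) :
  diffn l g -> diffn l h -> diffn l (fun z => g z + h z).
Proof.
elim: l g h => [|l IH] g h dg dh.
  by apply: diffn0 => z; apply: (differentiableD (f := g) (g := h));
    [exact: diffn_differentiable dg|exact: diffn_differentiable dh].
have [dg0 dgi] := (diffnS _ _).1 dg; have [dh0 dhi] := (diffnS _ _).1 dh.
apply/diffnS; split=> [z|i]; first exact: (differentiableD (f := g) (g := h)).
rewrite (_ : partial i _ = fun z => partial i g z + partial i h z);
  first exact: IH.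
by apply/funext => z; rewrite partialD.
Qed.

Lemma diffnM n l (g h : 'rV[R]_n -> R) :
  diffn l g -> diffn l h -> diffn l (fun z => g z * h z).
Proof.
elim: l g h => [|l IH] g h dg dh.
  by apply: diffn0 => z; apply: (differentiableM (f := g) (g := h));
    [exact: diffn_differentiable dg|exact: diffn_differentiable dh].
have [dg0 dgi] := (diffnS _ _).1 dg; have [dh0 dhi] := (diffnS _ _).1 dh.
apply/diffnS; split=> [z|i]; first exact: (differentiableM (f := g) (g := h)).
rewrite (_ : partial i _ = fun z => g z * partial i h z + h z * partial i g z).
  by apply: diffnD; apply: IH => //; exact: diffnW.
by apply/funext => z; rewrite partialM.
Qed.

Lemma diffn_sum n l (I : Type) (r : seq I) (h : I -> 'rV[R]_n -> R) :
  (forall j, diffn l (h j)) -> diffn l (fun z => \sum_(j <- r) h j z).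
Proof.
move=> dh; elim: r => [|j r IH].
  by under eq_fun do rewrite big_nil; exact: diffn_cst.
by under eq_fun do rewrite big_cons; exact: diffnD.
Qed.

(** The induction is over all [g] at once: the chain rule replaces [g] by its partial derivatives,
    which have one order less, while [F] stays the same. *)
Lemma diffn_comp n k l (g : 'rV[R]_k -> R) (F : 'rV[R]_n -> 'rV[R]_k) :
  diffn l g -> (forall j, diffn l (fun z => F z 0 j)) -> diffn l (g \o F).
Proof.
elim: l g => [|l IH] g dg dF.
  apply: diffn0 => z; apply: differentiable_comp;
    last exact: diffn_differentiable dg.
  by apply: differentiable_rVP => j; exact: diffn_differentiable (dF j).
have [dg0 dgi] := (diffnS _ _).1 dg.
have dF0 j z := (((diffnS _ _).1 (dF j)).1) z.
apply/diffnS; split=> [z|i].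
  by apply: differentiable_comp => //; exact: differentiable_rVP.
rewrite (_ : partial i _ = fun z => \sum_j
    (partial j g \o F) z * partial i (fun y => F y 0 j) z).
  apply: diffn_sum => j; apply: diffnM; last exact: ((diffnS _ _).1 (dF j)).2.
  by apply: IH => // j'; exact: diffnW.
by apply/funext => z; rewrite partial_comp.
Qed.

Lemma diffnV n l (g : 'rV[R]_n -> R) :
  (forall z, g z != 0) -> diffn l g -> diffn l (fun z => (g z)^-1).
Proof.
move=> g0; elim: l => [|l IH] dg.
  by apply: diffn0 => z; apply: differentiableV => //;
    exact: diffn_differentiable dg.
have [dg0 dgi] := (diffnS _ _).1 dg.
apply/diffnS; split=> [z|i]; first exact: differentiableV.
(* The derivative is written with two separate factors [(g z)^-1], so that the induction hypothesis
   applies to each of them. *)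
rewrite (_ : partial i _ =
    fun z => (-1 * (g z)^-1 * (g z)^-1) * partial i g z).
  apply: diffnM => //; apply: diffnM; last exact/IH/diffnW.
  by apply: diffnM; [exact: diffn_cst|exact/IH/diffnW].
apply/funext => z; rewrite /partial [LHS]deriveV//; last exact: diff_derivable.
by rewrite -exprVn /GRing.scale/=; ring.
Qed.

(** A single differentiation turns the logarithm into a product with [(g z)^-1], which [diffnV]
    handles, so no induction is required. *)
Lemma diffn_ln n l (g : 'rV[R]_n -> R) :
  (forall z, 0 < g z) -> diffn l g -> diffn l (fun z => ln (g z)).
Proof.
move=> g0 dg; have dl z : differentiable (fun z => ln (g z)) z.
  apply: differentiable_comp1; last exact: diffn_differentiable dg.
  by apply: ex_derive; exact: is_derive1_ln.
case: l dg => [|l] dg; first exact: diffn0.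
have [dg0 dgi] := (diffnS _ _).1 dg.
apply/diffnS; split=> // i.
rewrite (_ : partial i _ = fun z => (g z)^-1 * partial i g z).
  apply: diffnM => //; apply: diffnV; last exact: diffnW.
  by move=> z; rewrite gt_eqF.
apply/funext => z.
by apply: (@partial_comp1 _ _ (@ln R) g) => //; exact: is_derive1_ln.
Qed.

Lemma diffn_coord n l (j : 'I_n) : diffn l (fun z : 'rV[R]_n => z 0 j).
Proof.
case: l => [|l]; first by apply: diffn0 => z; exact: differentiable_coord.
apply/diffnS; split=> [z|i]; first exact: differentiable_coord.
rewrite (_ : partial i _ = fun=> (i == j)%:R); first exact: diffn_cst.
by apply/funext => z; exact: partial_coord.
Qed.

Lemma smooth_cst n (c : R) : smooth (fun _ : 'rV[R]_n => c).
Proof. by apply/smoothP => l; exact: diffn_cst. Qed.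

Lemma smoothD n (g h : 'rV[R]_n -> R) :
  smooth g -> smooth h -> smooth (fun z => g z + h z).
Proof. by rewrite !smoothP => sg sh l; exact: diffnD. Qed.

Lemma smoothM n (g h : 'rV[R]_n -> R) :
  smooth g -> smooth h -> smooth (fun z => g z * h z).
Proof. by rewrite !smoothP => sg sh l; exact: diffnM. Qed.

Lemma smooth_sum n (I : Type) (r : seq I) (h : I -> 'rV[R]_n -> R) :
  (forall j, smooth (h j)) -> smooth (fun z => \sum_(j <- r) h j z).
Proof.
by move=> sh; apply/smoothP => l; apply: diffn_sum => j;
  exact: (smoothP _).1 (sh j) l.
Qed.

Lemma smooth_comp n k (g : 'rV[R]_k -> R) (F : 'rV[R]_n -> 'rV[R]_k) :
  smooth g -> smooth_map F -> smooth (g \o F).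
Proof.
move=> /smoothP sg sF; apply/smoothP => l; apply: diffn_comp => //.
by move=> j; exact: (smoothP _).1 (sF j) l.
Qed.

Lemma smooth_ln n (g : 'rV[R]_n -> R) :
  (forall z, 0 < g z) -> smooth g -> smooth (fun z => ln (g z)).
Proof. by move=> g0; rewrite !smoothP => sg l; exact: diffn_ln. Qed.

Lemma smooth_coord n (j : 'I_n) : smooth (fun z : 'rV[R]_n => z 0 j).
Proof. by apply/smoothP => l; exact: diffn_coord. Qed.

Lemma smooth_map_lsubmx d : smooth_map (lsubmx : 'rV[R]_(d + d) -> 'rV[R]_d).
Proof. by move=> j; under eq_fun do rewrite mxE; exact: smooth_coord. Qed.

Lemma smooth_map_rsubmx d : smooth_map (rsubmx : 'rV[R]_(d + d) -> 'rV[R]_d).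
Proof. by move=> j; under eq_fun do rewrite mxE; exact: smooth_coord. Qed.

End smooth_functions.

(** * Symmetry of second derivatives and Taylor bounds *)

Section second_order.
Context {R : realType}.

Lemma norm_rV_le n (z : 'rV[R]_n) (C : R) :
  0 <= C -> (forall i, `|z 0 i| <= C) -> `|z| <= C.
Proof.
move=> C0 zC; have -> : `|z| = mx_norm z by [].
by rewrite mx_normrE; apply: bigmax_le => // -[a b] _; rewrite ord1.
Qed.

Lemma coord_norm_le n (z : 'rV[R]_n) i : `|z 0 i| <= `|z|.
Proof.
have -> : `|z| = mx_norm z by [].
rewrite mx_normrE.
exact: (le_bigmax 0 (fun ij => `|z ij.1 ij.2|) (ord0, i)).
Qed.

Lemma norm_le_enorm n (z : 'rV[R]_n) : `|z| <= enorm z.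
Proof.
apply: norm_rV_le => [|i]; first exact: sqrtr_ge0.
rewrite -sqrtr_sqr; apply: ler_wsqrtr; rewrite /dotv (bigD1 i)//= -expr2 lerDl.
by apply: sumr_ge0 => j _; rewrite -expr2 sqr_ge0.
Qed.

Lemma norm_delta_mx_le n (i : 'I_n) : `|delta_mx 0 i : 'rV[R]_n| <= 1.
Proof.
by apply: norm_rV_le => // j; rewrite mxE; case: (_ && _);
  rewrite ?normr1 ?normr0.
Qed.

(* Both mixed derivatives are limits of the same double difference. *)
Lemma double_difference n (g : 'rV[R]_n -> R) (z : 'rV[R]_n) i j (h : R) :
  smooth g -> exists2 w : 'rV[R]_n, `|w - z| <= 2 * `|h| &
  g (z + h *: delta_mx 0 i + h *: delta_mx 0 j) - g (z + h *: delta_mx 0 i)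
  - g (z + h *: delta_mx 0 j) + g z = h ^+ 2 * partial j (partial i g) w.
Proof.
move=> sg; set ei := delta_mx 0 i; set ej := delta_mx 0 j.
have sum1 (k : 'I_n) (F : 'I_n -> R) :
    \sum_a (h *: delta_mx 0 k : 'rV[R]_n) 0 a * F a = h * F k.
  rewrite (bigD1 k)//= big1 => [|a ak].
    by rewrite !mxE !eqxx addr0 mulr1.
  by rewrite !mxE eqxx (negPf ak) mulr0 mul0r.
pose phi y := g (y + h *: ej) + - g y.
have dg y : differentiable g y by exact: smooth_differentiable.
have dgj y : differentiable (fun y => g (y + h *: ej)) y.
  by apply: (differentiable_comp (g := g)).
have pgj y : partial i (fun y => g (y + h *: ej)) y = partial i g (y + h *: ej).
  rewrite /partial /derive; set A := (X in lim (X @ _)).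
  set B := (X in _ = lim (X @ _)).
  by have -> : A = B by apply/funext => a; rewrite /A /B/= /shift/= addrA.
have dphi y : differentiable phi y.
  by apply: differentiableD => //; exact: (differentiableN (f := g)).
(* The double difference is the increment of [phi] along [ei]. The mean value theorem is used first
   for [phi] along [ei], then for [partial i g] along [ej]. *)
have [c /itvP c01 E1] := MVT_line z (h *: ei) dphi.
rewrite sum1 in E1.
have [c' /itvP c'01 E2] := MVT_line (z + c *: (h *: ei)) (h *: ej)
  (fun y => smooth_differentiable y (smooth_partial i sg)).
rewrite sum1 in E2.
exists (z + c *: (h *: ei) + c' *: (h *: ej)).
  rewrite -[z + _ + _]addrA [z + _]addrC addrK (le_trans (ler_normD _ _))//.
  rewrite mulr_natl mulr2n lerD// !normrZ mulrCA ler_piMr//.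
    rewrite mulr_ile1// ?norm_delta_mx_le// ger0_norm ?c01//.
  by rewrite mulr_ile1// ?norm_delta_mx_le// ger0_norm ?c'01.
have -> : g (z + h *: ei + h *: ej) - g (z + h *: ei) - g (z + h *: ej) + g z
  = phi (z + h *: ei) - phi z by rewrite /phi; ring.
rewrite E1 partialD//; last exact: (differentiableN (f := g)).
by rewrite partialN// pgj E2; ring.
Qed.

Lemma partialC n (g : 'rV[R]_n -> R) i j z : smooth g ->
  partial i (partial j g) z = partial j (partial i g) z.
Proof.
move=> sg; apply/eqP; rewrite -subr_eq0 -normr_le0; apply/ler_addgt0Pr => e e0.
rewrite add0r.
have cont a b := smooth_continuous (smooth_partial a (smooth_partial b sg)).
have e20 : 0 < e / 2 by rewrite divr_gt0.
have [r1 /= r10 B1] := (nbhs_ballP _ _).1 ((cvgrPdist_lt _ _).1 (cont i j z) _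
  e20).
have [r2 /= r20 B2] := (nbhs_ballP _ _).1 ((cvgrPdist_lt _ _).1 (cont j i z) _
  e20).
pose q := Num.min r1 r2.
have q0 : 0 < q by rewrite lt_min r10.
have [qr1 qr2] : q <= r1 /\ q <= r2 by rewrite !ge_min !lexx orbT.
(* With a third of [q], the bound [2 * |h|] on the distance of the intermediate points to [z] is
   strictly below both radii. *)
clearbody q; pose h := q / 3.
have h0 : 0 < h by rewrite divr_gt0.
have hq : 2 * `|h| < q by rewrite gtr0_norm// /h; lra.
have [w1 Hw1 E1] := double_difference z i j h sg.
have [w2 Hw2 E2] := double_difference z j i h sg.
(* The double difference is symmetric in [i] and [j]; dividing by [h ^+ 2] equates the two mixed
   derivatives, though at two different points near [z]. *)
have E : partial j (partial i g) w1 = partial i (partial j g) w2.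
  apply: (mulfI (x := h ^+ 2)); first by rewrite expf_neq0// gt_eqF.
  rewrite -[RHS]E2 -[LHS]E1 (addrAC z).
  by congr (_ + _); exact: addrAC.
have /B2 : ball z r2 w1.
  by rewrite -ball_normE/= distrC; exact: le_lt_trans Hw1 (lt_le_trans hq qr2).
have /B1 : ball z r1 w2.
  by rewrite -ball_normE/= distrC; exact: le_lt_trans Hw2 (lt_le_trans hq qr1).
rewrite E => H1 H2.
move: H1 H2; move: (partial i (partial j g) w2) (partial i (partial j g) z)
  (partial j (partial i g) z) => a b c bae cae.
clear -bae cae.
rewrite -(subrKA a) (le_trans (ler_normD _ _))//.
by rewrite (splitr e) lerD// ltW//= distrC.
Qed.

Lemma MVT_partial_bound n (g : 'rV[R]_n -> R) (C : R) z v :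
  (forall y, differentiable g y) -> (forall i y, `|partial i g y| <= C) ->
  `|g (z + v) - g z| <= n%:R * C * `|v|.
Proof.
move=> dg gC; have [c _ ->] := MVT_line z v dg.
apply: le_trans (ler_norm_sum _ _ _) _.
have -> : n%:R * C * `|v| = \sum_(i < n) `|v| * C.
  by rewrite sumr_const card_ord -mulr_natl; ring.
by apply: ler_sum => i _; rewrite normrM ler_pM// coord_norm_le.
Qed.

Lemma taylor_bound n (g : 'rV[R]_n -> R) (C : R) z v : smooth g ->
  (forall i j y, `|partial i (partial j g) y| <= C) ->
  `|g (z + v) - g z - \sum_i v 0 i * partial i g z|
    <= n%:R ^+ 2 * C * `|v| ^+ 2.
Proof.
move=> sg gC; have dg y := smooth_differentiable y sg.
have [c /itvP c01 ->] := MVT_line z v dg.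
rewrite -sumrB; apply: le_trans (ler_norm_sum _ _ _) _.
have -> : n%:R ^+ 2 * C * `|v| ^+ 2 = \sum_(i < n) `|v| * (n%:R * C * `|v|).
  by rewrite sumr_const card_ord -mulr_natl; ring.
apply: ler_sum => i _; rewrite -mulrBr normrM ler_pM// ?coord_norm_le//.
(* The summation index [i] excludes [n = 0], so [gC] bounds at least one absolute value and forces
   [C] to be nonnegative. *)
have C0 : 0 <= n%:R * C.
  by case: n i {z sg dg v} g gC => [[]//|n] i g gC;
    rewrite mulr_ge0// (le_trans _ (gC i i 0)).
apply: le_trans (MVT_partial_bound (C := C) _ _ _ _) _ => //.
- by move=> y; exact/smooth_differentiable/smooth_partial.
- by rewrite ler_wpM2l// normrZ ler_piMl// ger0_norm c01.
Qed.

End second_order.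

(** * Borel sets and Lebesgue measure on row vectors *)

Section borel_rV.
Context {R : realType} {n : nat}.
Implicit Types g : 'rV[R]_n -> R.

(** Closed balls of the sup norm when [r] is nonnegative. The coordinatewise form suits both the
    generators of the sigma-algebra and the product construction of Lebesgue measure. *)
Definition box (c : 'rV[R]_n) (r : R) : set 'rV[R]_n :=
  [set z | forall i, `|z 0 i - c 0 i| <= r].

Lemma measurable_box c r : measurable (box c r).
Proof.
rewrite (_ : box c r = \bigcap_(i in [set: 'I_n])
    ((fun z : 'rV[R]_n => z 0 i) @^-1` [set x | `|x - c 0 i| <= r]));
      last first.
  by apply/seteqP; split=> z /= zr => [i _|i]; apply: zr.
apply: fin_bigcap_measurable => [|i _]; first exact: finite_finset.
rewrite -[X in measurable X]setTI; apply: measurable_coord => //.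
rewrite (_ : mkset _ = `[c 0 i - r, c 0 i + r]%classic);
  first exact: measurable_itv.
by apply/seteqP; split=> x /=; rewrite in_itv/= ler_distl.
Qed.

(** An open set is the union of the countably many boxes with rational centre and radius that it
    contains. *)
Lemma open_measurable_rV (O : set 'rV[R]_n) : open O -> measurable O.
Proof.
move=> oO; pose B (p : 'rV[rat]_n * rat) := box (map_mx ratr p.1) (ratr p.2).
rewrite (_ : O = \bigcup_p (if `[< B p `<=` O >] then B p else set0)).
  apply: countable_bigcupT_measurable => // p; case: ifP => // _.
  exact: measurable_box.
apply/seteqP; split=> [z Oz|z [p _]]; last by case: asboolP => // BO /BO.
have /nbhs_ballP[e /= e0 zeO] := open_nbhs_nbhs (conj oO Oz).
have e20 : 0 < e / 2 by rewrite divr_gt0.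
(* A radius below [e / 2] suffices: two points of one box are at distance at most twice its radius,
   hence below [e]. *)
have [r /itvP re] := rat_in_itvoo e20.
have /choice[q qz] : forall i, exists q : rat,
    ratr q \in `](z 0 i - ratr r), (z 0 i + ratr r)[.
  by move=> i; apply: rat_in_itvoo; rewrite ltrD2l gtrN// re.
have zr i : `|z 0 i - ratr (q i)| <= ratr r.
  have /itvP zq := qz i.
  by rewrite distrC ler_distl; apply/andP; split; apply: ltW; rewrite zq.
exists (\row_i q i, r) => //; case: asboolP => [_|]; first by move=> i;
  rewrite !mxE.
case=> y By; apply: zeO; rewrite -ball_normE/=.
apply: (@le_lt_trans _ _ (ratr r + ratr r)).
  apply: norm_rV_le => [|i]; first by rewrite addr_ge0// re.
  have := By i; rewrite !mxE /= => yr.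
  rewrite -(subrKA (ratr (q i))) (le_trans (ler_normD _ _))// lerD//.
  by rewrite distrC.
by rewrite (splitr e) ltrD// re.
Qed.

Lemma continuous_measurable_rV g : continuous g -> measurable_fun setT g.
Proof.
move=> cg; apply: (measurability _ (RGenOpens.measurableE R)).
move=> _ [_ [a [b ->] <-]]; rewrite setTI; apply: open_measurable_rV.
by apply: open_comp => //; exact: interval_open.
Qed.

Lemma continuous_bounded_support g (r : R) : continuous g ->
  (forall z, r < `|z| -> g z = 0) -> exists2 C, 0 <= C & forall z, `|g z| <= C.
Proof.
(* The maximum with [0] keeps the compact ball nonempty when [r] is negative, as the extreme value
   theorem requires. *)
move=> cg g0; pose A := [set z : 'rV[R]_n | `|z| <= Num.max r 0].
have cA : compact A.
  apply: bounded_closed_compact.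
    by exists (Num.max r 0); split => [|M rM z /= /le_trans];
      [exact: num_real|apply; exact: ltW].
  exact: (closed_comp (f := fun z : 'rV[R]_n => `|z|)
    (fun z _ => @norm_continuous _ _ z) (@closed_le R (Num.max r 0))).
have A0 : A !=set0 by exists 0; rewrite /A/= normr0 le_max lexx orbT.
have [|c _ Hc] := EVT_max_rV (f := fun z => `|g z|) A0 cA.
  by apply: continuous_subspaceT => z; apply: continuous_comp (cg z) _;
    exact: norm_continuous.
exists `|g c| => // z; have [zr|rz] := leP `|z| (Num.max r 0).
  by apply: Hc; rewrite inE.
by rewrite g0 ?normr0//; move: rz; rewrite gt_max => /andP[].
Qed.

End borel_rV.

(** * Integrability on row vectors, and integrals against a density *)

Section lebesgue_rV_integrals.
Context {R : realType}.

(** By induction on the dimension: a box is the product of an interval and a lower-dimensional box,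
    and dimension zero carries a Dirac mass. *)
Lemma lebesgue_box_lty n (r : R) :
  (lebesgue_rV (box (0 : 'rV[R]_n) r) < +oo)%E.
Proof.
elim: n => [|n IH]; first by rewrite /= diracE ltry.
have -> : @lebesgue_rV R n.+1 (box 0 r) =
    (lebesgue_measure \x @lebesgue_rV R n)%E (`[- r, r]%classic `*` box 0 r).
  congr (_ \x _)%E; apply/seteqP; split=> -[a z] /=.
    move=> H; split=> [|i].
      by have := H ord0; rewrite consrV0 mxE subr0 in_itv/= ler_norml.
    by have := H (lift ord0 i); rewrite consrVS !mxE.
  rewrite in_itv/= => -[ar H] i; have [j ->|->] := unliftP ord0 i.
    by rewrite consrVS !mxE; have := H j; rewrite mxE.
  by rewrite consrV0 mxE subr0 ler_norml.
rewrite product_measure1E//; last exact: measurable_box.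
have := IH; rewrite -ge0_fin_numE// => fb.
have : lebesgue_measure (`[- r, r]%classic : set R) \is a fin_num.
  by rewrite lebesgue_measure_itv/=; case: ifP.
by move=> fi; rewrite ltey_eq fin_numM.
Qed.

Lemma continuous_bounded_support_integrable n (g : 'rV[R]_n -> R) (r : R) :
  continuous g -> (forall z, r < `|z| -> g z = 0) ->
  lebesgue_rV.-integrable setT (EFin \o g).
Proof.
move=> cg g0; have [C C0 gC] := continuous_bounded_support cg g0.
have -> : EFin \o g = (EFin \o g) \_ (box 0 r).
  apply/funext => z; rewrite patchE; case: ifPn => //= /negP zr.
  rewrite g0// ltNge; apply/negP => rz; apply: zr; rewrite inE => i.
  by rewrite mxE subr0 (le_trans _ rz)// coord_norm_le.
apply: (iffLR (integrable_mkcond _ (measurable_box 0 r))).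
apply: measurable_bounded_integrable.
- exact: measurable_box.
- exact: lebesgue_box_lty.
- apply: measurable_funTS; exact: continuous_measurable_rV.
- exists C; split; first exact: num_real.
  by move=> M CM z _; apply: le_trans (gC z) _; exact: ltW.
Qed.

(** The law of [Y] is absolutely continuous, and [f] agrees almost everywhere with its Radon-Nikodym
    derivative because both have the same integral over every measurable set. *)
Lemma integral_density n d (Om : measurableType d) (P : probability Om R)
    (Y : Om -> 'rV[R]_n) (f phi : 'rV[R]_n -> R) :
  measurable_fun setT Y -> measurable_fun setT f -> measurable_fun setT phi ->
  (forall z, 0 <= phi z) ->
  lebesgue_rV.-integrable setT (EFin \o f) ->
  (forall A, measurable A ->
     pushforward P Y A = (\int[lebesgue_rV]_(z in A) (f z)%:E)%E) ->
  (\int[P]_w (phi (Y w))%:E < +oo)%E ->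
  (\int[lebesgue_rV]_z (phi z * f z)%:E = \int[P]_w (phi (Y w))%:E)%E.
Proof.
move=> mY mf mphi phi0 intf law EphiY.
pose MY := isMeasurableFun.Build _ _ _ _ _ mY.
pose Y' : {mfun Om >-> 'rV[R]_n} := HB.pack Y MY.
pose nu : probability _ R := distribution P Y'.
have nulam : nu `<< @lebesgue_rV R n.
  apply/null_content_dominatesP => A mA A0.
  rewrite [LHS]law//; apply: null_set_integral => //.
  by apply/measurable_EFinP; exact: measurable_funTS.
have Ephi : (\int[nu]_z (phi z)%:E = \int[P]_w (phi (Y w))%:E)%E.
  rewrite [LHS]ge0_integral_distribution//.
  exact/measurable_EFinP.
have iphi : nu.-integrable setT (EFin \o phi).
  apply/integrableP; split; first exact/measurable_EFinP.
  under eq_integral do rewrite /= ger0_norm//.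
  by rewrite Ephi.
rewrite -Ephi -(Radon_Nikodym_change_of_variables nulam measurableT iphi).
apply: ae_eq_integral => //.
- by apply/measurable_EFinP; exact: measurable_funM.
- apply: emeasurable_funM; first exact/measurable_EFinP.
  by apply: measurable_int; apply: Radon_Nikodym_integrable.
- have : ae_eq (@lebesgue_rV R n) setT (EFin \o f)
      (Radon_Nikodym (charge_of_finite_measure nu) (@lebesgue_rV R n)).
    apply: integral_ae_eq => //.
    move=> E _ mE; rewrite -Radon_Nikodym_integral//.
    by rewrite -[LHS]law.
  by apply: filterS => z /= H _; rewrite -H// EFinM.
Qed.

End lebesgue_rV_integrals.

(** * Algebra and bounds for real-valued integrals *)

Section real_integrable.
Context d (T : measurableType d) (R : realType).
Variable mu : {measure set T -> \bar R}.
Implicit Types g h : T -> R.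
Local Notation intR g := (mu.-integrable setT (EFin \o g)).

Lemma integrableD_EFin g h : intR g -> intR h -> intR (fun z => g z + h z).
Proof. by move=> ig ih; exact: (integrableD measurableT ig ih). Qed.

Lemma integrableB_EFin g h : intR g -> intR h -> intR (fun z => g z - h z).
Proof. by move=> ig ih; exact: (integrableB measurableT ig ih). Qed.

Lemma integrableZ_EFin (c : R) g : intR g -> intR (fun z => c * g z).
Proof. by move=> ig; exact: (integrableZl measurableT c ig). Qed.

Lemma integrable_sum_EFin (I : Type) (r : seq I) (h : I -> T -> R) :
  (forall i, intR (h i)) -> intR (fun z => \sum_(i <- r) h i z).
Proof.
move=> ih; elim: r => [|i r IH].
  under eq_fun do rewrite big_nil; exact: integrable0.
by under eq_fun do rewrite big_cons; exact: integrableD_EFin.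
Qed.

Lemma Rintegral_sum (I : Type) (r : seq I) (h : I -> T -> R) :
  (forall i, intR (h i)) ->
  \int[mu]_z (\sum_(i <- r) h i z) = \sum_(i <- r) \int[mu]_z h i z.
Proof.
move=> ih; elim: r => [|i r IH].
  under eq_Rintegral do rewrite big_nil.
  by rewrite big_nil /Rintegral integral0.
under eq_Rintegral do rewrite big_cons.
by rewrite RintegralD// ?IH ?big_cons//; exact: integrable_sum_EFin.
Qed.

Lemma le_integrable_EFin g h : measurable_fun setT g ->
  (forall z, `|g z| <= h z) -> intR h -> intR g.
Proof.
move=> mg gh ih; apply: (le_integrable measurableT _ _ ih).
  exact/measurable_EFinP.
by move=> z _ /=; rewrite lee_fin (le_trans (gh z))// ler_norm.
Qed.

Lemma norm_Rintegral_le g h : intR g -> intR h ->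
  (forall z, `|g z| <= h z) -> `|\int[mu]_z g z| <= \int[mu]_z h z.
Proof.
move=> ig ih gh; apply: le_trans (le_normr_Rintegral measurableT ig) _.
apply: le_Rintegral => //.
by apply: le_integrable_EFin ih => [|z]; rewrite ?normr_id//;
  apply: measurableT_comp => //;
  apply/measurable_EFinP; exact: measurable_int ig.
Qed.

End real_integrable.

(** The sum of the absolute values of the individual constants dominates each of them. *)
Lemma uniform_bound {R : realType} (I : finType) (Q : I -> R -> Prop) :
  (forall i a b, a <= b -> Q i a -> Q i b) ->
  (forall i, exists C, Q i C) -> exists2 C, 0 <= C & forall i, Q i C.
Proof.
move=> Qle /choice[C QC]; exists (\sum_i `|C i|); first exact: sumr_ge0.
move=> i; apply: Qle (QC i); rewrite (bigD1 i)//=.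
by rewrite ler_wpDr ?sumr_ge0// ler_norm.
Qed.

Lemma finite_bound {R : realType} (I : finType) (T : Type) (F : I -> T -> R) :
  (forall i, exists C, forall y, F i y <= C) ->
  exists2 C, 0 <= C & forall i y, F i y <= C.
Proof.
by apply: uniform_bound => i a b ab Fa y; exact: le_trans (Fa y) ab.
Qed.

(** A quadratic remainder is [o(|v|)], which identifies the differential. Convolutions are
    differentiated through this criterion, by integrating a Taylor remainder. *)
Lemma differentiable_quadratic {R : realType} n (g : 'rV[R]_n -> R) x
    (a : 'I_n -> R) (C : R) :
  (forall v, `|g (x + v) - g x - \sum_i v 0 i * a i| <= C * `|v| ^+ 2) ->
  differentiable g x /\ forall i, partial i g x = a i.
Proof.
move=> gC; pose l (v : 'rV[R]_n) : R := \sum_i v 0 i * a i.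
have l_lin : linear l.
  move=> c u v; rewrite /l scaler_sumr -big_split/=; apply: eq_bigr => i _.
  by rewrite !mxE /GRing.scale/=; ring.
pose lM := GRing.isLinear.Build _ _ _ _ _ l_lin.
pose L : {linear 'rV[R]_n -> R} := HB.pack l lM.
have cL : continuous L.
  move=> v; apply: differentiable_continuous; apply: differentiable_sumr => i.
  apply: (differentiableM (f := fun v : 'rV[R]_n => v 0 i) (g := fun=> a i)).
    exact: differentiable_coord.
  exact: differentiable_cst.
have E : (g : _ -> R^o) \o shift x =
    cst (g x : R^o) + (L : 'rV[R]_n -> R^o) +o_ (0 : 'rV[R]_n) id.
  apply/eqaddoP => _/posnumP[e].
  pose D : R := `|C| + 1.
  have D0 : 0 < D by rewrite ltr_pwDr.
  near=> v.
  rewrite [X in X <= _](_ : _ = `|g (x + v) - g x - L v|); last first.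
    by congr `|_|; rewrite -addrA -opprD /= [x + v]addrC.
  apply: le_trans (gC v) _.
  apply: (@le_trans _ _ (D * `|v| ^+ 2)).
    by rewrite ler_wpM2r ?exprn_ge0// ler_wpDr// ler_norm.
  rewrite expr2 mulrA ler_wpM2r// mulrC -ler_pdivlMr//.
  have : `|v| < e%:num / D.
    near: v; apply/nbhs_ballP; exists (e%:num / D);
      first by rewrite /= divr_gt0.
    by move=> y; rewrite -ball_normE/= sub0r normrN.
  exact: ltW.
have dL : 'd g x = L :> (_ -> _) by apply: diff_unique cL E.
have dg : differentiable g x.
  by apply/diff_locallyP; rewrite dL.
split=> // i; rewrite /partial deriveE// dL /= /l (bigD1 i)//= big1 => [|j ji].
  by rewrite mxE !eqxx mul1r addr0.
by rewrite mxE eqxx (negPf ji) mul0r.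
Unshelve. all: by end_near. Qed.

(** * Convolution with a tame potential *)

Section convolution.
Context {R : realType} {d : nat}.
Implicit Types (k : 'rV[R]_d -> R) (f : 'rV[R]_(d + d) -> R).
Local Notation lam := (@lebesgue_rV R (d + d)).

(** The second moment in position is what makes the convolution with a potential of quadratic growth
    converge. *)
Record moment_density f : Prop := {
  md_continuous : continuous f;
  md_ge0 : forall z, 0 <= f z;
  md_integrable : lam.-integrable setT (EFin \o f);
  md_mass : \int[lam]_z f z = 1;
  md_moment : lam.-integrable setT (EFin \o (fun z => `|lsubmx z| ^+ 2 * f z))
    }.

(** Only derivatives of order at least two are bounded, so quadratic growth is allowed; the class is
    stable under [partial]. *)
Definition tame k : Prop := smooth k /\
  forall s : seq 'I_d, (2 <= size s)%N ->
    exists C : R, forall x, `|partials s k x| <= C.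

Lemma tame_partial k i : tame k -> tame (partial i k).
Proof.
move=> [sk bk]; split=> [|s s2]; first exact: smooth_partial.
have [|C kC] := bk (rcons s i); first by rewrite size_rcons leqW.
by exists C => x; have := kC x; rewrite /partials foldr_rcons.
Qed.

Lemma tame_taylor k : tame k -> exists2 C, 0 <= C & forall x v,
  `|k (x + v) - k x - \sum_i v 0 i * partial i k x| <= C * `|v| ^+ 2.
Proof.
move=> [sk bk].
have [|C C0 kC] := @finite_bound R ('I_d * 'I_d)%type _
    (fun ij x => `|partial ij.1 (partial ij.2 k) x|).
  by move=> [i j]; exact: (bk [:: i; j]).
exists (d%:R ^+ 2 * C); first by rewrite mulr_ge0.
by move=> x v; apply: taylor_bound => // i j y; exact: (kC (i, j)).
Qed.

Lemma tame_partial_lipschitz k i : tame k -> exists2 C, 0 <= C & forall x v,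
  `|partial i k (x + v) - partial i k x| <= C * `|v|.
Proof.
move=> [sk bk].
have [|C C0 kC] := @finite_bound R 'I_d _ (fun j x => `|partial j (partial i k)
  x|).
  by move=> j; exact: (bk [:: j; i]).
exists (d%:R * C); first by rewrite mulr_ge0.
move=> x v; apply: MVT_partial_bound => // y.
exact/smooth_differentiable/smooth_partial.
Qed.

Lemma continuous_translate_lsubmx k x : continuous k ->
  continuous (fun z : 'rV[R]_(d + d) => k (x - lsubmx z)).
Proof.
move=> ck z; apply: (continuous_comp (f := fun z => x - lsubmx z));
  last exact: ck.
apply: (continuousB (f := fun=> x) (g := lsubmx)).
  exact: cst_continuous.
exact: continuous_lsubmx.
Qed.

Section fixed_density.
Variable f : 'rV[R]_(d + d) -> R.
Hypothesis mdf : moment_density f.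

Lemma conv_integrable k x : tame k ->
  lam.-integrable setT (EFin \o (fun z => k (x - lsubmx z) * f z)).
Proof.
move=> tk; have [C C0 kC] := tame_taylor tk.
(* Taylor's formula at [x] with increment [- p] bounds [k (x - p)] by [B * (1 + |p| ^+ 2)]; the term
   linear in [|p|] is absorbed by [p1]. *)
pose B := `|k x| + \sum_i `|partial i k x| + C.
apply: (@le_integrable_EFin _ _ _ _ _
    (fun z => B * (f z + `|lsubmx z| ^+ 2 * f z))).
- apply: continuous_measurable_rV => z.
  apply: (continuousM (s := fun z => k (x - lsubmx z)) (t := f)).
    by apply: continuous_translate_lsubmx; exact: smooth_continuous tk.1.
  exact: md_continuous.
- move=> z; rewrite normrM (ger0_norm (md_ge0 mdf z)).
  rewrite -[X in _ * (X + _)]mul1r -mulrDl mulrA ler_wpM2r ?(md_ge0 mdf)//.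
  set p := lsubmx z; have := kC x (- p); rewrite normrN => {}kC.
  have p2 : 1 <= 1 + `|p| ^+ 2 by rewrite lerDl exprn_ge0.
  have p1 : `|p| <= 1 + `|p| ^+ 2.
    by have := sqr_ge0 (`|p| - 1); have := normr_ge0 p; nra.
  have S : `|\sum_i (- p) 0 i * partial i k x| <=
      (\sum_i `|partial i k x|) * (1 + `|p| ^+ 2).
    apply: le_trans (ler_norm_sum _ _ _) _; rewrite mulr_suml.
    apply: ler_sum => i _; rewrite normrM mulrC ler_wpM2l//.
    by apply: le_trans p1; rewrite mxE normrN coord_norm_le.
  move: S kC; set S := \sum_i _; set k1 := k (x - p) => HS kC.
  have -> : k1 = (k1 - k x - S) + (k x + S) by ring.
  apply: le_trans (ler_normD _ _) _.
  rewrite /B addrC 2!mulrDl; apply: lerD.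
    apply: le_trans (ler_normD _ _) _; apply: lerD => //.
    by rewrite ler_peMr.
  by apply: le_trans kC _; rewrite ler_wpM2l// lerDr.
- apply: integrableZ_EFin; apply: integrableD_EFin; last exact: md_moment.
  exact: md_integrable.
Qed.

(** A remainder bound that is uniform in the base point survives averaging against a density of mass
    one, with the same constant. *)
Lemma conv_remainder k (C : R) x v : tame k ->
  (forall y, `|k (y + v) - k y - \sum_i v 0 i * partial i k y| <= C) ->
  `|conv k f (x + v) - conv k f x - \sum_i v 0 i * conv (partial i k) f x| <= C.
Proof.
move=> tk kC.
have ik y : lam.-integrable setT (EFin \o (fun z => k (y - lsubmx z) * f z)).
  exact: conv_integrable.
have ipk i : lam.-integrable setT
    (EFin \o (fun z => v 0 i * (partial i k (x - lsubmx z) * f z))).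
  by apply: integrableZ_EFin; apply: conv_integrable; exact: tame_partial.
have -> : \sum_i v 0 i * conv (partial i k) f x =
    \int[lam]_z \sum_i v 0 i * (partial i k (x - lsubmx z) * f z).
  rewrite Rintegral_sum//; apply: eq_bigr => i _.
  by rewrite /conv RintegralZl//; apply: conv_integrable; exact: tame_partial.
rewrite /conv -RintegralB// -RintegralB//; last 2 first.
  exact: integrableB_EFin.
  exact: integrable_sum_EFin.
have <- : \int[lam]_z (C * f z) = C.
  by rewrite RintegralZl ?md_mass ?mulr1//; exact: md_integrable.
apply: norm_Rintegral_le.
- apply: integrableB_EFin; first exact: integrableB_EFin.
  exact: integrable_sum_EFin.
- by apply: integrableZ_EFin; exact: md_integrable.
move=> z; have := kC (x - lsubmx z); set y := x - lsubmx z => {}kC.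
rewrite [x + v - _]addrAC -/y.
have -> : k (y + v) * f z - k y * f z - \sum_i v 0 i * (partial i k y * f z)
    = (k (y + v) - k y - \sum_i v 0 i * partial i k y) * f z.
  rewrite !mulrBl mulr_suml; congr (_ - _).
  by apply: eq_bigr => i _; rewrite mulrA.
by rewrite normrM (ger0_norm (md_ge0 mdf z)) ler_wpM2r ?(md_ge0 mdf).
Qed.

Lemma conv_increment k (C : R) x v : tame k ->
  (forall y, `|k (y + v) - k y| <= C) ->
  `|conv k f (x + v) - conv k f x| <= C.
Proof.
move=> tk kC; have ik y := conv_integrable y tk.
rewrite /conv -RintegralB//.
have <- : \int[lam]_z (C * f z) = C.
  by rewrite RintegralZl ?md_mass ?mulr1//; exact: md_integrable.
apply: norm_Rintegral_le.
- exact: integrableB_EFin.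
- by apply: integrableZ_EFin; exact: md_integrable.
move=> z; rewrite [x + v - _]addrAC -mulrBl normrM (ger0_norm (md_ge0 mdf z)).
by rewrite ler_wpM2r ?(md_ge0 mdf).
Qed.

Lemma differentiable_conv k x : tame k -> differentiable (conv k f) x /\
  forall i, partial i (conv k f) x = conv (partial i k) f x.
Proof.
move=> tk; have [C C0 kC] := tame_taylor tk.
by apply: (@differentiable_quadratic _ _ _ _ _ C) => v; exact: conv_remainder.
Qed.

Lemma partial_conv k i : tame k -> partial i (conv k f) = conv (partial i k) f.
Proof. by move=> tk; apply/funext => x;
  have [_ ->] := differentiable_conv x tk. Qed.

(** Derivatives fall on [k], which stays tame, so the induction on the order runs over all tame
    potentials together. *)
Lemma smooth_conv k : tame k -> smooth (conv k f).
Proof.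
move=> tk; apply/smoothP => l; elim: l k tk => [|l IH] k tk.
  by apply: diffn0 => x; have [] := differentiable_conv x tk.
apply/diffnS; split=> [x|i]; first by have [] := differentiable_conv x tk.
by rewrite partial_conv//; apply: IH; exact: tame_partial.
Qed.

End fixed_density.

Lemma bounded_partials k : smooth k -> bounded_higher_derivatives k -> tame k.
Proof.
move=> sk bk; split=> // s s2; have [C kC] := bk _ s2.
exists C => x; apply: le_trans (kC x); rewrite /tensor_norm -sqrtr_sqr.
rewrite ler_wsqrtr// (bigD1 (in_tuple s))//= lerDl sumr_ge0// => s' _.
exact: sqr_ge0.
Qed.

End convolution.

(** * First variation of the entropy *)

Section entropy_variation.
Context {R : realType}.

Lemma ln_le_subr1 (x : R) : 0 < x -> ln x <= x - 1.
Proof.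
by move=> x0; rewrite lerBrDl; have := expR_ge1Dx (ln x); rewrite lnK// posrE.
Qed.

(** With [x = (a + b) / a] the middle term is [(a + b) * ln x - b]. The upper bound is
    [ln x <= x - 1]; the lower one is the same inequality at [x^-1]. *)
Lemma entropy_remainder (a b : R) : 0 < a -> 0 < a + b ->
  0 <= (a + b) * ln (a + b) - a * ln a - b * (ln a + 1) <= b ^+ 2 / a.
Proof.
move=> a0 ab0; pose x := (a + b) / a.
have x0 : 0 < x by rewrite divr_gt0.
have -> : ln (a + b) = ln a + ln x.
  by rewrite -lnM ?posrE// /x mulrC divfK// gt_eqF.
have -> : (a + b) * (ln a + ln x) - a * ln a - b * (ln a + 1)
  = (a + b) * ln x - b by ring.
have a1 : a != 0 by rewrite gt_eqF.
have ab1 : a + b != 0 by rewrite gt_eqF.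
have lx : ln x <= x - 1 by exact: ln_le_subr1.
have lxV : - ln x <= x^-1 - 1.
  by rewrite -lnV ?posrE//; apply: ln_le_subr1; rewrite invr_gt0.
apply/andP; split.
  rewrite subr_ge0 -ler_pdivrMl//.
  have -> : (a + b)^-1 * b = 1 - x^-1 by rewrite /x; field; rewrite a1.
  by move: lxV; move: (ln x) (x^-1) => p q; clear; lra.
rewrite lerBlDr -ler_pdivlMl//; apply: le_trans lx _.
rewrite le_eqVlt; apply/orP; left; apply/eqP; rewrite /x; field.
by rewrite a1.
Qed.

Lemma is_derive_quadratic (g : R -> R) (l C r : R) : 0 < r ->
  (forall e, `|e| < r -> `|g e - g 0 - e * l| <= C * e ^+ 2) ->
  is_derive (0 : R) (1 : R) g l.
Proof.
move=> r0 gC.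
suff cv : h^-1 *: ((g \o shift 0) (h *: (1 : R)) - g 0) @[h --> 0^'] --> l.
  by apply: DeriveDef; [apply/cvg_ex; exists l|exact: cvg_lim cv].
apply/cvgrPdist_le => eps eps0.
have D0 : 0 < `|C| + 1 by rewrite ltr_pwDr.
near=> h.
have h0 : h != 0 by near: h; exact: nbhs_dnbhs_neq.
have hr : `|h| < r by near: h; exact: dnbhs0_lt.
have he : `|h| < eps / (`|C| + 1) by near: h; apply: dnbhs0_lt;
  rewrite divr_gt0.
have -> : (g \o shift 0) (h *: (1 : R)) = g h.
  by rewrite /= /shift addr0 /GRing.scale/= mulr1.
have -> : l - h^-1 *: (g h - g 0) = - (h^-1 * (g h - g 0 - h * l)).
  by rewrite /GRing.scale/=; field.
rewrite normrN normrM normfV ler_pdivrMl ?normr_gt0//.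
apply: le_trans (gC h hr) _.
have -> : C * h ^+ 2 = `|h| * (`|h| * C).
  by rewrite -[h ^+ 2]real_normK ?num_real//; ring.
rewrite ler_wpM2l//; move: he; rewrite ltr_pdivlMr// => /ltW; apply: le_trans.
by rewrite ler_wpM2l// (le_trans (ler_norm C))// lerDl.
Unshelve. all: by end_near. Qed.

Lemma continuous_lnV n (u : 'rV[R]_n -> R) : continuous u ->
  (forall z, 0 < u z) -> continuous (fun z => ln (u z)).
Proof.
by move=> cu u0 z; apply: continuous_comp (cu z) _; exact: continuous_ln.
Qed.

(** The term with [H] is linear in [w], so the second-order remainder comes from the entropy alone.
    It is at most [e ^+ 2 * chi ^+ 2 / u], which is integrable because [chi] has bounded support and
    [u] is continuous and positive. *)
Lemma entropy_first_variation n (u H : 'rV[R]_n -> R) (c : R) :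
  let F w := (\int[lebesgue_rV]_z (w z * ln (w z) + c * (w z * H z))%:E)%E in
  continuous u -> (forall z, 0 < u z) -> continuous H -> F u \is a fin_num ->
  first_variation F u (fun z => ln (u z) + 1 + c * H z).
Proof.
move=> F cu u0 cH Fu chi [schi [r chir]] _.
have cchi := smooth_continuous schi.
have chi0 z : r < `|z| -> chi z = 0.
  by move=> rz; apply: chir; exact: lt_le_trans rz (norm_le_enorm z).
have cuV : continuous (fun z => (u z)^-1).
  by move=> z; apply: continuousV (cu z); rewrite gt_eqF.
have cln := continuous_lnV cu u0.
have cM (g h : 'rV[R]_n -> R) :
    continuous g -> continuous h -> continuous (fun z => g z * h z).
  by move=> cg ch z; exact: continuousM (cg z) (ch z).
have cD (g h : 'rV[R]_n -> R) :
    continuous g -> continuous h -> continuous (fun z => g z + h z).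
  by move=> cg ch z; exact: continuousD (cg z) (ch z).
have cc (a : R) : continuous (fun _ : 'rV[R]_n => a) by exact: cst_continuous.
pose G w z := w z * ln (w z) + c * (w z * H z).
have cG (w : 'rV[R]_n -> R) : continuous w -> (forall z, 0 < w z) -> continuous
  (G w).
  move=> cw w0; apply: (cD); first by apply: (cM) => //; exact: continuous_lnV.
  by apply: (cM) => //; exact: cM.
have iG : lebesgue_rV.-integrable setT (EFin \o G u).
  have mG := continuous_measurable_rV (cG _ cu u0).
  apply/integrableP; split; first exact/measurable_EFinP.
  by rewrite integral_fin_num_abs.
pose psi z := ln (u z) + 1 + c * H z.
have ipsi : lebesgue_rV.-integrable setT (EFin \o (fun z => psi z * chi z)).
  apply: (@continuous_bounded_support_integrable _ _ _ r).
    by apply: (cM) => //; apply: (cD); [exact: cD|exact: cM].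
  by move=> z /chi0 ->; rewrite mulr0.
pose q z := chi z * chi z * (u z)^-1.
have iq : lebesgue_rV.-integrable setT (EFin \o q).
  apply: (@continuous_bounded_support_integrable _ _ _ r).
    by apply: (cM) => //; exact: cM.
  by move=> z /chi0; rewrite /q => ->; rewrite !mul0r.
have [C C0 chiuC] : exists2 C, 0 <= C & forall z, `|chi z * (u z)^-1| <= C.
  apply: (@continuous_bounded_support _ _ _ r); first exact: cM.
  by move=> z /chi0 ->; rewrite mul0r.
(* As [C] bounds [|chi / u|], any [e] with [|e| < rho] keeps [u + e * chi] positive everywhere;
   adding 1 covers the case [C = 0]. *)
pose rho := (C + 1)^-1.
have C10 : 0 < C + 1 by rewrite ltr_wpDl.
have rho0 : 0 < rho by rewrite invr_gt0.
have pos e z : `|e| < rho -> 0 < u z + e * chi z.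
  move=> erho; have : `|e * (chi z * (u z)^-1)| < 1.
    rewrite normrM (@le_lt_trans _ _ (`|e| * (C + 1)))//.
      by rewrite ler_wpM2l// (le_trans (chiuC z))// lerDl.
    by rewrite -ltr_pdivlMr// mul1r.
  rewrite ltr_norml => /andP[lo _].
  have -> : u z + e * chi z = u z * (1 + e * (chi z * (u z)^-1)).
    by field; rewrite gt_eqF.
  by rewrite mulr_gt0// -ltrBlDl sub0r.
pose w e z := u z + e * chi z.
have cw e : continuous (w e) by apply: (cD) => //; exact: cM.
pose rem e z := G (w e) z - G u z - e * (psi z * chi z).
have rem_le e z : `|e| < rho -> `|rem e z| <= e ^+ 2 * q z.
  move=> erho; have := entropy_remainder (u0 z) (pos e z erho).
  have -> : (e * chi z) ^+ 2 / u z = e ^+ 2 * q z by rewrite /q; ring.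
  have -> : rem e z = (u z + e * chi z) * ln (u z + e * chi z)
      - u z * ln (u z) - e * chi z * (ln (u z) + 1).
    by rewrite /rem /G /w /psi; ring.
  by case/andP=> rem0; rewrite ger0_norm.
have irem e : `|e| < rho -> lebesgue_rV.-integrable setT (EFin \o rem e).
  move=> erho; apply: (@le_integrable_EFin _ _ _ _ _ (fun z => e ^+ 2 * q z)).
  (* The remainder is recast with sums and products only, to derive measurability from continuity
     through [cD] and [cM]. *)
  - have -> : rem e = fun z => G (w e) z + (-1 * G u z + - e * (psi z * chi z)).
      by apply/funext => z; rewrite /rem; ring.
    apply: continuous_measurable_rV; apply: (cD).
      by apply: cG => // z; exact: pos.
    apply: (cD); first by apply: (cM) => //; exact: cG.
    apply: (cM) => //; apply: (cM) => //; apply: (cD); [exact: cD|exact: cM].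
  - by move=> z; exact: rem_le.
  - exact: integrableZ_EFin.
have Gw e : G (w e) = fun z => G u z + e * (psi z * chi z) + rem e z.
  by apply/funext => z; rewrite /rem; ring.
have iGw e : `|e| < rho -> lebesgue_rV.-integrable setT (EFin \o G (w e)).
  move=> erho; rewrite Gw; apply: integrableD_EFin; last exact: irem.
  by apply: integrableD_EFin => //; exact: integrableZ_EFin.
split.
  near=> e; rewrite [F _](_ : _ = \int[lebesgue_rV]_z (EFin \o G (w e)) z)%E//.
  apply: integrable_fin_num => //; apply: iGw.
  by near: e; apply/nbhs_ballP; exists rho => //= e;
    rewrite /ball/= sub0r normrN.
pose Q := \int[lebesgue_rV]_z q z.
apply: (@is_derive_quadratic _ _ Q rho) => // e erho.
rewrite -/(w e) -/(w 0).
have fineF a : fine (F (w a)) = \int[lebesgue_rV]_z G (w a) z by [].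
have -> : w 0 = u by apply/funext => z; rewrite /w mul0r addr0.
rewrite fineF [fine (F u)](_ : _ = \int[lebesgue_rV]_z G u z)//.
rewrite Gw RintegralD//; last 2 first.
- by apply: integrableD_EFin => //; exact: integrableZ_EFin.
- exact: irem.
rewrite RintegralD//; last exact: integrableZ_EFin.
rewrite RintegralZl//.
set A := \int[_]_z G u z; set B := \int[_]_z (psi z * chi z).
have -> : A + e * B + \int[lebesgue_rV]_z rem e z - A - e * B
   = \int[lebesgue_rV]_z rem e z by ring.
rewrite mulrC /Q -RintegralZl//; apply: norm_Rintegral_le.
- exact: irem.
- exact: integrableZ_EFin.
- by move=> z; exact: rem_le.
Unshelve. all: by end_near. Qed.

End entropy_variation.

(** * The symplectic flow *)

Section time_derivative.
Context {R : realType}.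
Variable T : R.

Lemma near_time_within (t : R) (P : R -> Prop) :
  (\forall s \near within `[0, T] t^', P s) <->
  exists2 e, 0 < e &
    forall s, `|t - s| < e -> s != t -> 0 <= s <= T -> P s.
Proof.
split=> [[e /= e0 H]|[e e0 H]].
  by exists e => // s ts st sT; apply: (H s) => //; rewrite /= in_itv/= sT.
by exists e => // s /= ts st; rewrite in_itv/=; exact: H.
Qed.

Lemma has_dt_coord n (g : R -> 'rV[R]_n) t l i : has_dt T g t l ->
  has_dt T (fun s => g s 0 i : R^o) t (l 0 i).
Proof.
move=> gl; apply/cvgrPdist_le => e e0.
have [r r0 H] := (near_time_within _ _).1 ((cvgrPdist_le _ _).1 gl e e0).
apply/near_time_within; exists r => // s ts st sT.
apply: le_trans (H s ts st sT).
by have := coord_norm_le (l - (s - t)^-1 *: (g s - g t)) i; rewrite !mxE.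
Qed.

Lemma has_dt_is_derive (g : R -> R) t l : 0 < t < T ->
  has_dt T (g : R -> R^o) t l -> is_derive t (1 : R) g l.
Proof.
move=> /andP[t0 tT] gl.
suff cv : h^-1 *: ((g \o shift t) (h *: (1 : R)) - g t) @[h --> 0^'] --> l.
  by apply: DeriveDef; [apply/cvg_ex; exists l|exact: cvg_lim cv].
apply/cvgrPdist_le => e e0.
have [r r0 H] := (near_time_within _ _).1 ((cvgrPdist_le _ _).1 gl e e0).
(* Besides the radius [r], the distances from [t] to [0] and [T] keep [h + t] inside the time
   interval. *)
pose r' := Num.min r (Num.min t (T - t)).
have r'0 : 0 < r' by rewrite !lt_min r0 t0 subr_gt0.
near=> h.
have h0 : h != 0 by near: h; exact: nbhs_dnbhs_neq.
have : `|h| < r' by near: h; exact: dnbhs0_lt.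
rewrite !lt_min => /and3P[hr]; rewrite !ltr_norml => /andP[h1 h2] /andP[h3 h4].
have -> : (g \o shift t) (h *: (1 : R)) = g (h + t).
  by rewrite /= /shift /GRing.scale/= mulr1.
have := H (h + t); rewrite addrK; apply.
- by rewrite opprD addrCA subrr addr0 normrN.
- by rewrite -subr_eq0 addrK.
- by apply/andP; split; lra.
Unshelve. all: by end_near. Qed.

Definition time_continuous (g : R -> R) : Prop := forall t, 0 <= t <= T ->
  g s @[s --> within `[0, T] (nbhs t)] --> g t.

(** Near [t] the difference quotient is within 1 of its limit [l], so [|g t - g s|] is at most
    [(|l| + 1) * |t - s|]. *)
Lemma has_dt_continuous (g : R -> R) :
  (forall t, 0 <= t <= T -> exists l, has_dt T (g : R -> R^o) t l) ->
  time_continuous g.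
Proof.
move=> dg t tT; have [l gl] := dg t tT; apply/cvgrPdist_le => e e0.
have [r r0 H] := (near_time_within _ _).1 ((cvgrPdist_le _ _).1 gl 1 ltr01).
have L0 : 0 < `|l| + 1 by rewrite ltr_wpDl.
exists (Num.min r (e / (`|l| + 1))); first by rewrite /= lt_min r0 divr_gt0.
move=> s /=; rewrite lt_min => /andP[ts tse]; rewrite in_itv/= => sT.
have [->|st] := eqVneq s t; first by rewrite subrr normr0 ltW.
have := H s ts st sT; set q := (s - t)^-1 *: (g s - g t : R^o) => lq.
have -> : g t - g s = (t - s) * q.
  by rewrite /q /GRing.scale/=; field; rewrite subr_eq0.
rewrite normrM; apply: (@le_trans _ _ (`|t - s| * (`|l| + 1))).
  rewrite ler_wpM2l// -[q](subKr l); apply: le_trans (ler_normB _ _) _.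
  by rewrite lerD2l.
by move: tse; rewrite ltr_pdivlMr// => /ltW.
Qed.

Lemma time_continuousB (g h : R -> R) : time_continuous g ->
  time_continuous h -> time_continuous (fun s => g s - h s).
Proof. by move=> cg ch t tT; apply: cvgB; [exact: cg|exact: ch]. Qed.

Lemma time_continuousM (g h : R -> R) : time_continuous g ->
  time_continuous h -> time_continuous (fun s => g s * h s).
Proof. by move=> cg ch t tT; apply: cvgM; [exact: cg|exact: ch]. Qed.

Lemma time_continuous_sum (I : Type) (r : seq I) (h : I -> R -> R) :
  (forall i, time_continuous (h i)) ->
  time_continuous (fun s => \sum_(i <- r) h i s).
Proof.
move=> ch t tT; apply: (@cvg_big R^o I +%R 0 xpredT) => [|i _].
  exact: add_continuous.
exact: ch.
Qed.

Lemma continuous_time (g : R -> R) : continuous g -> time_continuous g.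
Proof. by move=> cg t tT; apply: cvg_within_filter; exact: cg. Qed.

Lemma time_MVT (g dg : R -> R) t : 0 <= t <= T -> time_continuous g ->
  (forall s, 0 < s < T -> is_derive s (1 : R) g (dg s)) ->
  exists2 s, 0 <= s <= T & g t - g 0 = dg s * t.
Proof.
move=> /andP[]; rewrite le_eqVlt => /predU1P[<-|t0] tT cg Dg.
  by exists 0; rewrite ?lexx ?subrr ?mulr0.
have [||s /itvP st] := @MVT R g dg 0 t t0.
- move=> s; rewrite in_itv/= => /andP[s0 st]; apply: Dg.
  by rewrite s0 (lt_le_trans st).
- have : {within `[0, T], continuous g}.
    by apply/subspace_continuousP => s /=; rewrite in_itv/=; exact: cg.
  apply: continuous_subspaceW => s /=; rewrite !in_itv/= => /andP[-> st].
  exact: le_trans st tT.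
- by rewrite subr0 => ->; exists s => //; rewrite st (le_trans _ tT)// ltW// st.
Qed.

(** The derivative of [E s * expR (- c * s)] is nonpositive, and the mean value theorem compares the
    values of this product at [0] and [t]. *)
Lemma gronwall (E dE : R -> R) (c t : R) : 0 <= t <= T -> time_continuous E ->
  (forall s, 0 < s < T -> is_derive s (1 : R) E (dE s)) ->
  (forall s, 0 <= s <= T -> dE s <= c * E s) ->
  E t <= E 0 * expR (c * t).
Proof.
move=> tT cE DE bE.
pose x s := expR (- c * s).
have Dx s : is_derive s (1 : R) x (- c * x s).
  have Dl : is_derive s (1 : R) (fun s => - c * s) (- c).
    have := is_deriveZ (- c) (is_derive_id s (1 : R)).
    by rewrite /GRing.scale/= mulr1.
  have := is_derive1_comp (is_derive_expR (- c * s)) Dl.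
  by move/is_derive_eq; apply; rewrite mulrC.
have cx : time_continuous x.
  by apply: continuous_time => s; exact: is_derive_continuous (Dx s).
have [s sT] := @time_MVT (fun s => E s * x s)
    (fun s => E s * (- c * x s) + x s * dE s) t tT (time_continuousM cE cx)
    (fun s sT => is_deriveM (DE s sT) (Dx s)).
have -> : E s * (- c * x s) + x s * dE s = x s * (dE s - c * E s) by ring.
have t0 : 0 <= t by case/andP: tT.
have : x s * (dE s - c * E s) * t <= 0.
  by rewrite mulr_le0_ge0// mulr_ge0_le0 ?expR_ge0// subr_le0 bE.
move=> H HE; move: H; rewrite -HE subr_le0 {2}/x mulr0 expR0 mulr1 => H.
by rewrite -ler_pdivrMr ?expR_gt0// -expRN -mulNr.
Qed.

End time_derivative.

(** * Invariance of the symplectic form under a second-order flow *)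

Section symplectic_flow.
Context {R : realType} {d : nat}.
Local Notation phase := 'rV[R]_(d + d).
Local Notation xi k := (lshift d k).
Local Notation vi k := (rshift d k).

(** The canonical symplectic form on phase space. *)
Definition omega (a b : phase) : R :=
  \sum_(k < d) (a 0 (xi k) * b 0 (vi k) - a 0 (vi k) * b 0 (xi k)).

Lemma omegaZ (h : R) a b : omega (h *: a) (h *: b) = h ^+ 2 * omega a b.
Proof.
by rewrite /omega mulr_sumr; apply: eq_bigr => k _; rewrite !mxE; ring.
Qed.

Lemma is_derive_sumr n (h : 'I_n -> R -> R) (dh : 'I_n -> R) (t : R) :
  (forall i, is_derive t (1 : R) (h i) (dh i)) ->
  is_derive t (1 : R) (fun s => \sum_i h i s) (\sum_i dh i).
Proof.
move=> H; have := is_derive_sum H.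
by congr (is_derive _ _ _ _); apply/funext => s; rewrite fct_sumE.
Qed.

(** [N] is minus the acceleration and [H] its spatial Jacobian, entering only through a Taylor bound
    uniform in time; symmetry of [H] expresses that the force derives from a potential. *)
Variables (T : R) (N : R -> 'rV[R]_d -> 'rV[R]_d).
Variables (H : R -> 'rV[R]_d -> 'I_d -> 'I_d -> R) (L C : R).
Hypotheses (L0 : 0 <= L) (C0 : 0 <= C).
Hypothesis N_lipschitz : forall s x v k, 0 <= s <= T ->
  `|N s (x + v) 0 k - N s x 0 k| <= L * `|v|.
Hypothesis N_taylor : forall s x v k, 0 <= s <= T ->
  `|N s (x + v) 0 k - N s x 0 k - \sum_j v 0 j * H s x k j| <= C * `|v| ^+ 2.
Hypothesis H_sym : forall s x j k, H s x j k = H s x k j.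

Let b s (z : phase) : phase := row_mx (rsubmx z) (- N s (lsubmx z)).

Definition solution (Z : R -> phase) : Prop :=
  forall t, 0 <= t <= T -> has_dt T Z t (b t (Z t)).

Section one_solution.
Variable Z : R -> phase.
Hypothesis sZ : solution Z.

Lemma solution_derive t i : 0 < t < T ->
  is_derive t (1 : R) (fun s => Z s 0 i) (b t (Z t) 0 i).
Proof.
move=> tT; apply: (has_dt_is_derive tT); apply: has_dt_coord.
by apply: sZ; case/andP: tT => /ltW -> /ltW.
Qed.

Lemma solution_continuous i : time_continuous T (fun s => Z s 0 i).
Proof.
apply: has_dt_continuous => t tT; exists (b t (Z t) 0 i).
by apply: has_dt_coord; exact: sZ.
Qed.

Lemma second_order_field_x t z k : b t z 0 (xi k) = z 0 (vi k).
Proof. by rewrite row_mxEl mxE. Qed.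

Lemma second_order_field_v t z k : b t z 0 (vi k) = - N t (lsubmx z) 0 k.
Proof. by rewrite row_mxEr mxE. Qed.

End one_solution.

Lemma norm_lsubmx_le (z : phase) : `|lsubmx z| <= `|z|.
Proof. by apply: norm_rV_le => // i; rewrite mxE; exact: coord_norm_le. Qed.

Lemma second_order_field_lipschitz s z z0 i : 0 <= s <= T ->
  `|b s z 0 i - b s z0 0 i| <= (1 + L) * `|z - z0|.
Proof.
move=> sT; have zz0 : lsubmx z = lsubmx z0 + lsubmx (z - z0).
  by apply/rowP => k; rewrite !mxE; ring.
case: (split_ordP i) => k ->.
  rewrite !second_order_field_x mulrDl mul1r (@le_trans _ _ `|z - z0|)//;
    last first.
    by rewrite lerDl mulr_ge0.
  by have := coord_norm_le (z - z0) (vi k); rewrite !mxE.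
rewrite !second_order_field_v zz0 -opprD normrN mulrDl mul1r.
apply: le_trans (N_lipschitz _ _ _ sT) _.
by rewrite ler_wpDl// ler_wpM2l// norm_lsubmx_le.
Qed.

(** Gronwall's lemma for the squared distance. [K] is chosen before the solutions, which makes
    increments of initial size [h] uniformly [O(h)] later on. *)
Lemma solutions_close : exists2 K, 0 <= K &
  forall Z Z0, solution Z -> solution Z0 -> forall t, 0 <= t <= T ->
  `|Z t - Z0 t| <= K * `|Z 0 - Z0 0|.
Proof.
pose n : R := (d + d)%:R; pose c := n * (2 * (1 + L)).
have n0 : 0 <= n by exact: ler0n.
have c0 : 0 <= c by rewrite !mulr_ge0// addr_ge0.
pose A := n * expR (c * T); have A0 : 0 <= A by rewrite mulr_ge0// expR_ge0.
exists (1 + A); first by rewrite addr_ge0.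
move=> Z Z0 sZ sZ0 t tT.
pose e i s := Z s 0 i - Z0 s 0 i.
pose de i s := b s (Z s) 0 i - b s (Z0 s) 0 i.
(* The squared Euclidean distance is differentiable in time, unlike the sup norm, and the two are
   comparable up to the factor [n]. *)
pose E s := \sum_i e i s * e i s.
have normE s : `|Z s - Z0 s| ^+ 2 <= E s.
  have : `|Z s - Z0 s| ^+ 2 <= enorm (Z s - Z0 s) ^+ 2.
    by rewrite ler_sqr ?nnegrE ?sqrtr_ge0// norm_le_enorm.
  rewrite sqr_sqrtr /dotv; last by apply: sumr_ge0 => i _;
    rewrite -expr2 sqr_ge0.
  by under eq_bigr do rewrite !mxE.
have e_le i s : `|e i s| <= `|Z s - Z0 s|.
  by have := coord_norm_le (Z s - Z0 s) i; rewrite !mxE.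
have cE : time_continuous T E.
  apply: time_continuous_sum => i; apply: time_continuousM;
  by apply: time_continuousB; exact: solution_continuous.
have DE s : 0 < s < T ->
    is_derive s (1 : R) E (\sum_i (e i s * de i s + e i s * de i s)).
  move=> sT; apply: is_derive_sumr => i.
  have De : is_derive s (1 : R) (e i) (de i s).
    exact: is_deriveB (solution_derive sZ i sT) (solution_derive sZ0 i sT).
  exact: is_deriveM.
have bE s : 0 <= s <= T ->
    \sum_i (e i s * de i s + e i s * de i s) <= c * E s.
  move=> sT; apply: (@le_trans _ _ (c * `|Z s - Z0 s| ^+ 2)); last first.
    by rewrite ler_wpM2l.
  rewrite /c -mulrA /n -[X in X%:R]card_ord mulr_natl -sumr_const.
  apply: ler_sum => i _.
  have -> : 2 * (1 + L) * `|Z s - Z0 s| ^+ 2 =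
    `|Z s - Z0 s| * ((1 + L) * `|Z s - Z0 s|)
    + `|Z s - Z0 s| * ((1 + L) * `|Z s - Z0 s|) by ring.
  have : e i s * de i s <= `|Z s - Z0 s| * ((1 + L) * `|Z s - Z0 s|).
    apply: le_trans (ler_norm _) _; rewrite normrM ler_pM//.
    exact: second_order_field_lipschitz.
  by move=> Hi; exact: lerD.
have Et := gronwall tT cE DE bE.
have E0 : E 0 <= n * `|Z 0 - Z0 0| ^+ 2.
  rewrite /n -[X in X%:R]card_ord mulr_natl -sumr_const.
  apply: ler_sum => i _.
  by apply: le_trans (ler_norm _) _; rewrite normrM expr2 ler_pM.
(* Gronwall yields the factor [A] on squares; bounding it by [(1 + A) ^+ 2] avoids a square root. *)
have : `|Z t - Z0 t| ^+ 2 <= ((1 + A) * `|Z 0 - Z0 0|) ^+ 2.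
  apply: le_trans (normE t) _; apply: le_trans Et _.
  apply: (@le_trans _ _ (A * `|Z 0 - Z0 0| ^+ 2)).
    apply: (le_trans (ler_wpM2r (expR_ge0 _) E0)).
    rewrite /A [leRHS]mulrAC; apply: ler_wpM2l; first by rewrite mulr_ge0.
    by rewrite ler_expR ler_wpM2l//; case/andP: tT.
  rewrite exprMn ler_wpM2r ?exprn_ge0//.
  have -> : (1 + A) ^+ 2 = A + (1 + A + A ^+ 2) by ring.
  by rewrite lerDl !addr_ge0// exprn_ge0.
by rewrite ler_sqr ?nnegrE// mulr_ge0// addr_ge0.
Qed.

(* The symmetric part of the difference of forces cancels, only the second
   order Taylor remainders contribute to the variation of [omega]. *)
Lemma omega_drift (Z0 Z1 Z2 : R -> phase) (B t : R) :
  solution Z0 -> solution Z1 -> solution Z2 -> 0 <= t <= T ->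
  (forall s, 0 <= s <= T -> `|Z1 s - Z0 s| <= B) ->
  (forall s, 0 <= s <= T -> `|Z2 s - Z0 s| <= B) ->
  `|omega (Z1 t - Z0 t) (Z2 t - Z0 t) - omega (Z1 0 - Z0 0) (Z2 0 - Z0 0)|
    <= d%:R * (2 * (C * B ^+ 3)) * T.
Proof.
move=> s0 s1 s2 tT B1 B2.
pose e1 i s := Z1 s 0 i - Z0 s 0 i; pose e2 i s := Z2 s 0 i - Z0 s 0 i.
pose d1 i s := b s (Z1 s) 0 i - b s (Z0 s) 0 i.
pose d2 i s := b s (Z2 s) 0 i - b s (Z0 s) 0 i.
pose W s := \sum_(k < d) (e1 (xi k) s * e2 (vi k) s - e1 (vi k) s * e2 (xi k)
  s).
have EW s : omega (Z1 s - Z0 s) (Z2 s - Z0 s) = W s.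
  by apply: eq_bigr => k _; rewrite !mxE.
rewrite !EW.
have c1 i : time_continuous T (e1 i).
  by apply: time_continuousB; exact: solution_continuous.
have c2 i : time_continuous T (e2 i).
  by apply: time_continuousB; exact: solution_continuous.
have D1 i s : 0 < s < T -> is_derive s (1 : R) (e1 i) (d1 i s).
  move=> sT.
  exact: is_deriveB (solution_derive s1 i sT) (solution_derive s0 i sT).
have D2 i s : 0 < s < T -> is_derive s (1 : R) (e2 i) (d2 i s).
  move=> sT.
  exact: is_deriveB (solution_derive s2 i sT) (solution_derive s0 i sT).
have cW : time_continuous T W.
  apply: time_continuous_sum => k.
  by apply: time_continuousB; exact: time_continuousM.
pose dW s := \sum_(k < d)
  ((e1 (xi k) s * d2 (vi k) s + e2 (vi k) s * d1 (xi k) s) -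
   (e1 (vi k) s * d2 (xi k) s + e2 (xi k) s * d1 (vi k) s)).
have DW s : 0 < s < T -> is_derive s (1 : R) W (dW s).
  move=> sT; apply: is_derive_sumr => k.
  by apply: is_deriveB; apply: is_deriveM;
    [exact: D1|exact: D2|exact: D1|exact: D2].
have [s sT ->] := time_MVT tT cW DW.
have t0 : 0 <= t by case/andP: tT.
have B0 : 0 <= B by apply: le_trans (B1 s sT).
rewrite normrM (ger0_norm t0); apply: ler_pM => //; last by case/andP: tT.
pose x := lsubmx (Z0 s).
pose p1 := lsubmx (Z1 s - Z0 s); pose p2 := lsubmx (Z2 s - Z0 s).
have p1B : `|p1| <= B by apply: le_trans (norm_lsubmx_le _) (B1 s sT).
have p2B : `|p2| <= B by apply: le_trans (norm_lsubmx_le _) (B2 s sT).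
pose r1 k := N s (x + p1) 0 k - N s x 0 k - \sum_j p1 0 j * H s x k j.
pose r2 k := N s (x + p2) 0 k - N s x 0 k - \sum_j p2 0 j * H s x k j.
have x1 : lsubmx (Z1 s) = x + p1 by apply/rowP => k; rewrite !mxE; ring.
have x2 : lsubmx (Z2 s) = x + p2 by apply/rowP => k; rewrite !mxE; ring.
have -> : dW s = \sum_(k < d) (p2 0 k * r1 k - p1 0 k * r2 k).
  have sym : \sum_k p1 0 k * (\sum_j p2 0 j * H s x k j) =
             \sum_k p2 0 k * (\sum_j p1 0 j * H s x k j).
    under eq_bigr do rewrite mulr_sumr.
    rewrite exchange_big/=; apply: eq_bigr => j _; rewrite mulr_sumr.
    by apply: eq_bigr => k _; rewrite (H_sym s x k j); ring.
  (* The velocity products cancel in [dW]. The added difference of bilinear sums, zero by [sym], is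
     the linear part of the forces. *)
  transitivity (\sum_(k < d) (p2 0 k * r1 k - p1 0 k * r2 k) +
     (\sum_k p2 0 k * (\sum_j p1 0 j * H s x k j) -
      \sum_k p1 0 k * (\sum_j p2 0 j * H s x k j))); last first.
    by rewrite sym subrr addr0.
  rewrite -sumrB -big_split/=; apply: eq_bigr => k _.
  rewrite /r1 /r2 /d1 /d2 /e1 /e2 !second_order_field_x !second_order_field_v
    x1 x2 /p1 /p2 !mxE.
  set S1 := \sum_j _; set S2 := \sum_j _; ring.
apply: le_trans (ler_norm_sum _ _ _) _.
rewrite -[X in X%:R]card_ord mulr_natl -sumr_const.
apply: ler_sum => k _; apply: le_trans (ler_normB _ _) _.
have rB p r : `|p| <= B -> `|r| <= C * `|p : 'rV[R]_d| ^+ 2 -> `|r| <= C * B ^+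
  2.
  by move=> pB /le_trans; apply; rewrite ler_wpM2l// ler_sqr ?nnegrE.
have -> : 2 * (C * B ^+ 3) = B * (C * B ^+ 2) + B * (C * B ^+ 2) by ring.
by apply: lerD; rewrite normrM ler_pM// ?(le_trans (coord_norm_le _ _))//;
  apply: rB (N_taylor _ _ _ sT).
Qed.

Variable Phi : R -> phase -> phase.
Hypothesis Phi_sol : forall z, solution (Phi^~ z).
Hypothesis Phi0 : forall z, Phi 0 z = z.

(** [omega] of the difference quotients [q i h] and [q j h] has two limits: the left-hand side by
    differentiability, and the initial value because the drift [O(h^3)] is divided only by
    [h ^+ 2]. *)
Lemma symplectic_flow t z i j : 0 <= t <= T ->
  (forall z k, differentiable (fun y => Phi t y 0 k) z) ->
  omega (\row_k partial i (fun y => Phi t y 0 k) z)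
        (\row_k partial j (fun y => Phi t y 0 k) z) =
  omega (delta_mx 0 i) (delta_mx 0 j).
Proof.
move=> tT dPhi; set ei := delta_mx 0 i; set ej := delta_mx 0 j.
pose q a (h : R) : phase := h^-1 *: (Phi t (h *: (delta_mx 0 a) + z) - Phi t z).
have cq a k : q a h 0 k @[h --> 0^'] --> partial a (fun y => Phi t y 0 k) z.
  have := diff_derivable (v := delta_mx 0 a) (dPhi z k).
  rewrite /derivable -/(derive _ _ _) => Hd.
  rewrite [X in X @ _ --> _](_ : _ = fun h : R => h^-1 *:
    (((fun y => Phi t y 0 k) \o shift z) (h *: delta_mx 0 a) - Phi t z 0 k :
      R^o)).
    exact: Hd.
  by apply/funext => h; rewrite !mxE.
have cv : omega (q i h) (q j h) @[h --> 0^'] -->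
    omega (\row_k partial i (fun y => Phi t y 0 k) z)
          (\row_k partial j (fun y => Phi t y 0 k) z).
  apply: (@cvg_big R^o 'I_d +%R 0 xpredT) => [|k _];
    first exact: add_continuous.
  rewrite !mxE; exact: cvgB (cvgM (cq _ _) (cq _ _)) (cvgM (cq _ _) (cq _ _)).
suff cv' : omega (q i h) (q j h) @[h --> 0^'] --> omega ei ej.
  exact: (cvg_unique _ cv cv').
have [K K0 close] := solutions_close.
have T0 : 0 <= T by case/andP: tT => /le_trans; apply.
(* This is the constant of [omega_drift] for [B = K * |h|], with the factor [|h| ^+ 3] removed. *)
pose M := d%:R * (2 * (C * K ^+ 3)) * T.
have M0 : 0 <= M by rewrite !mulr_ge0 ?exprn_ge0.
apply/cvgrPdist_le => e e0.
near=> h.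
have h0 : h != 0 by near: h; exact: nbhs_dnbhs_neq.
have he : `|h| < e / (M + 1).
  by near: h; apply: dnbhs0_lt; rewrite divr_gt0// ltr_wpDl.
have Bh a s : 0 <= s <= T ->
    `|Phi s (h *: delta_mx 0 a + z) - Phi s z| <= K * `|h|.
  move=> sT.
  have /le_trans := close _ _ (@Phi_sol (h *: delta_mx 0 a + z)) (@Phi_sol z) s
    sT.
  by apply; rewrite !Phi0 addrK ler_wpM2l// normrZ ler_piMr//
    norm_delta_mx_le//.
have := omega_drift (@Phi_sol z) (@Phi_sol (h *: ei + z)) (@Phi_sol (h *: ej +
  z))
  tT (Bh i) (Bh j).
rewrite !Phi0 !addrK omegaZ => drift.
rewrite /q omegaZ.
have -> : omega ei ej - h^-1 ^+ 2 * omega (Phi t (h *: ei + z) - Phi t z)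
    (Phi t (h *: ej + z) - Phi t z) =
  - (h^-1 ^+ 2 * (omega (Phi t (h *: ei + z) - Phi t z)
    (Phi t (h *: ej + z) - Phi t z) - h ^+ 2 * omega ei ej)).
  by move: (omega _ _) (omega _ _) => o1 o2; field.
rewrite normrN normrM.
apply: (@le_trans _ _ (`|h^-1 ^+ 2| * (M * `|h| ^+ 3))).
  rewrite ler_wpM2l//; apply: le_trans drift _.
  by rewrite le_eqVlt; apply/orP; left; apply/eqP; rewrite /M; ring.
have -> : `|h^-1 ^+ 2| * (M * `|h| ^+ 3) = M * `|h|.
  by rewrite normrX normfV; field; rewrite normr_eq0.
move: he; rewrite ltr_pdivlMr ?ltr_wpDl// => /ltW; apply: le_trans.
by rewrite mulrC ler_wpM2l// lerDl.
Unshelve. all: by end_near. Qed.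

End symplectic_flow.

(** * The mean-field system *)

Section densities.
Context {R : realType}.

Lemma enorm_sqr n (a : 'rV[R]_n) : enorm a ^+ 2 = \sum_i a 0 i * a 0 i.
Proof.
by rewrite sqr_sqrtr// /dotv; apply: sumr_ge0 => i _; rewrite -expr2 sqr_ge0.
Qed.

Lemma smooth_enorm_sqr n : smooth (fun a : 'rV[R]_n => enorm a ^+ 2).
Proof.
under eq_fun do rewrite enorm_sqr.
by apply: smooth_sum => i; apply: smoothM; exact: smooth_coord.
Qed.

Lemma smooth_lsubmx d (g : 'rV[R]_d -> R) : smooth g ->
  smooth (fun z : 'rV[R]_(d + d) => g (lsubmx z)).
Proof. by move=> sg; apply: (smooth_comp sg); exact: smooth_map_lsubmx. Qed.

Lemma smooth_rsubmx d (g : 'rV[R]_d -> R) : smooth g ->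
  smooth (fun z : 'rV[R]_(d + d) => g (rsubmx z)).
Proof. by move=> sg; apply: (smooth_comp sg); exact: smooth_map_rsubmx. Qed.

(** Total mass one comes from [P] being a probability; the second moment is carried from [Om] to
    phase space by [integral_density]. *)
Lemma moment_density_of_law d (dO : measure_display) (Om : measurableType dO)
    (P : probability Om R) (X V : Om -> 'rV[R]_d) (f : 'rV[R]_(d + d) -> R)
    (C : R) :
  measurable_fun setT (fun w => row_mx (X w) (V w)) ->
  continuous f -> (forall z, 0 <= f z) ->
  (forall A, measurable A -> pushforward P (fun w => row_mx (X w) (V w)) A =
    (\int[lebesgue_rV]_(z in A) (f z)%:E)%E) ->
  (\int[P]_w (enorm (X w) ^+ 2 + enorm (V w) ^+ 2)%:E <= C%:E)%E ->
  moment_density f.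
Proof.
move=> mY cf f0 law EC.
have mf : measurable_fun setT f by exact: continuous_measurable_rV.
have mass : (\int[lebesgue_rV]_z (f z)%:E = 1)%E.
  by rewrite -law// /pushforward preimage_setT probability_setT.
have intf : lebesgue_rV.-integrable setT (EFin \o f).
  apply/integrableP; split; first exact/measurable_EFinP.
  by under eq_integral do rewrite /= ger0_norm//; rewrite mass ltry.
(* The Euclidean expression matches the moment bound of the process and dominates the squared sup
   norm of the position. *)
pose phi (z : 'rV[R]_(d + d)) := enorm (lsubmx z) ^+ 2 + enorm (rsubmx z) ^+ 2.
have phi0 z : 0 <= phi z by rewrite addr_ge0// exprn_ge0// sqrtr_ge0.
have cphi : continuous phi.
  apply: smooth_continuous; apply: smoothD.
    by apply: (smooth_lsubmx (g := fun a => enorm a ^+ 2));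
      exact: smooth_enorm_sqr.
  by apply: (smooth_rsubmx (g := fun a => enorm a ^+ 2));
    exact: smooth_enorm_sqr.
have mphi := continuous_measurable_rV cphi.
have Ephi : (\int[P]_w (phi (row_mx (X w) (V w)))%:E < +oo)%E.
  apply: le_lt_trans (ltry C); apply: le_trans EC.
  by under eq_integral do rewrite /phi row_mxKl row_mxKr.
have iphi : lebesgue_rV.-integrable setT (EFin \o (fun z => phi z * f z)).
  apply/integrableP; split.
    by apply/measurable_EFinP; exact: measurable_funM.
  under eq_integral do rewrite /= ger0_norm ?mulr_ge0//.
  by rewrite (integral_density mY mf mphi phi0 intf law Ephi).
split=> //; first by rewrite /Rintegral mass.
apply: le_integrable_EFin iphi.
  apply: measurable_funM => //; apply: continuous_measurable_rV => z.
  have cn : {for z, continuous (fun z : 'rV[R]_(d + d) => `|lsubmx z|)}.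
    apply: (continuous_comp (f := lsubmx)); first exact: continuous_lsubmx.
    exact: norm_continuous.
  exact: (continuousM cn cn).
move=> z; rewrite ger0_norm ?mulr_ge0 ?exprn_ge0// ler_wpM2r//.
rewrite /phi (@le_trans _ _ (enorm (lsubmx z) ^+ 2))//.
  by rewrite ler_sqr ?nnegrE ?sqrtr_ge0// norm_le_enorm.
by rewrite lerDl exprn_ge0// sqrtr_ge0.
Qed.

Lemma langevin_moment_density d (T m gamma beta : R) (U K : 'rV[R]_d -> R)
    (dO : measure_display) (Om : measurableType dO) (P : probability Om R)
    (Fi : R -> set (set Om)) (B X V : R -> Om -> 'rV[R]_d)
    (f : R -> 'rV[R]_(d + d) -> R) (t : R) :
  normal_filtration P Fi -> langevin_solution P m gamma beta U K T Fi B X V ->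
  smooth_density P T X V f -> 0 <= t <= T -> moment_density (f t).
Proof.
move=> hFi hXV hf tT; have [C EC] := sol_moment hXV.
have t0 : 0 <= t by case/andP: tT.
have mcoord (Y : R -> Om -> 'rV[R]_d) i : adapted Fi `[0, T] Y ->
    measurable_fun setT (fun w => Y t w 0 i).
  move=> aY _ D mD; rewrite setTI; apply: (filt_measurable hFi t0).
  by apply: aY => //=; rewrite in_itv.
apply: (moment_density_of_law (P := P) (X := X t) (V := V t) (C := C)).
- apply: measurable_fun_coordP => i; case: (split_ordP i) => j ->.
    by under eq_fun do rewrite row_mxEl; exact: mcoord (sol_adaptedX hXV).
  by under eq_fun do rewrite row_mxEr; exact: mcoord (sol_adaptedV hXV).
- exact/smooth_continuous/(dens_smooth hf).
- by move=> z; exact: (dens_ge0 hf).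
- by move=> A mA; exact: (dens_law hf).
- exact: EC.
Qed.

End densities.

(** * Symplecticity of the mean-field Hamiltonian flow *)

Section mean_field_flow.
Context {R : realType} {d : nat}.

(** The Lipschitz and Taylor constants of the force are those of [U] and [K]: averaging against
    [f s] preserves them, so they are uniform in time without any time regularity of [f]. *)
Lemma mean_field_symplectic (T m : R) (U K : 'rV[R]_d -> R)
    (f : R -> 'rV[R]_(d + d) -> R) (Phi Phiinv : R -> 'rV[R]_(d + d) ->
      'rV[R]_(d + d)) :
  tame U -> tame K -> (forall t, 0 <= t <= T -> moment_density (f t)) ->
  is_flow T (fun t => bH m U K (f t)) Phi Phiinv ->
  forall t z i j, 0 <= t <= T ->
  omega (\row_k partial i (fun y => Phi t y 0 k) z)
        (\row_k partial j (fun y => Phi t y 0 k) z) =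
  omega (delta_mx 0 i) (delta_mx 0 j).
Proof.
move=> tU tK mdf hPhi t z i j tT.
have [N [NE bN]] : exists N : R -> 'rV[R]_d -> 'rV[R]_d,
    (forall s x k, N s x 0 k =
      m^-1 * partial k U x + m^-1 * conv (partial k K) (f s) x) /\
    (forall s z, bH m U K (f s) z = row_mx (rsubmx z) (- N s (lsubmx z))).
  exists (fun s x => m^-1 *: grad U x
    + m^-1 *: (\row_k conv (partial k K) (f s) x)); split.
    by move=> s x k; rewrite !mxE.
  by move=> s y; rewrite /bH opprD.
pose H s x k l := m^-1 * partial l (partial k U) x
  + m^-1 * conv (partial l (partial k K)) (f s) x.
have [LU LU0 HLU] : exists2 C, 0 <= C & forall k x v,
    `|partial k U (x + v) - partial k U x| <= C * `|v|.
  apply: uniform_bound => [k a b ab aH x v|k].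
    by apply: le_trans (aH x v) _; rewrite ler_wpM2r.
  by have [C _ HC] := tame_partial_lipschitz k tU; exists C.
have [LK LK0 HLK] : exists2 C, 0 <= C & forall k x v,
    `|partial k K (x + v) - partial k K x| <= C * `|v|.
  apply: uniform_bound => [k a b ab aH x v|k].
    by apply: le_trans (aH x v) _; rewrite ler_wpM2r.
  by have [C _ HC] := tame_partial_lipschitz k tK; exists C.
have [CU CU0 HCU] : exists2 C, 0 <= C & forall k x v,
    `|partial k U (x + v) - partial k U x
      - \sum_l v 0 l * partial l (partial k U) x| <= C * `|v| ^+ 2.
  apply: uniform_bound => [k a b ab aH x v|k].
    by apply: le_trans (aH x v) _; rewrite ler_wpM2r// exprn_ge0.
  by have [C _ HC] := tame_taylor (tame_partial k tU); exists C.
have [CK CK0 HCK] : exists2 C, 0 <= C & forall k x v,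
    `|partial k K (x + v) - partial k K x
      - \sum_l v 0 l * partial l (partial k K) x| <= C * `|v| ^+ 2.
  apply: uniform_bound => [k a b ab aH x v|k].
    by apply: le_trans (aH x v) _; rewrite ler_wpM2r// exprn_ge0.
  by have [C _ HC] := tame_taylor (tame_partial k tK); exists C.
apply: (@symplectic_flow R d T N H (`|m^-1| * (LU + LK)) (`|m^-1| * (CU + CK))).
- by rewrite mulr_ge0// addr_ge0.
- by rewrite mulr_ge0// addr_ge0.
- move=> s x v k sT; rewrite (NE s (x + v)) (NE s x).
  have -> (a b a' b' : R) : m^-1 * a + m^-1 * a' - (m^-1 * b + m^-1 * b') =
    m^-1 * ((a - b) + (a' - b')) by ring.
  rewrite normrM -mulrA ler_wpM2l// mulrDl; apply: le_trans (ler_normD _ _) _.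
  apply: lerD; first exact: HLU.
  apply: conv_increment; [exact: mdf|exact: tame_partial|].
  by move=> y; exact: HLK.
- move=> s x v k sT; rewrite (NE s (x + v)) (NE s x) /H.
  have -> : \sum_l v 0 l * (m^-1 * partial l (partial k U) x
        + m^-1 * conv (partial l (partial k K)) (f s) x) =
      m^-1 * (\sum_l v 0 l * partial l (partial k U) x
        + \sum_l v 0 l * conv (partial l (partial k K)) (f s) x).
    rewrite -big_split/= mulr_sumr; apply: eq_bigr => l _; ring.
  have -> (a b a' b' S S' : R) : m^-1 * a + m^-1 * a' - (m^-1 * b + m^-1 * b')
    - m^-1 * (S + S') =
    m^-1 * ((a - b - S) + (a' - b' - S')) by ring.
  rewrite normrM -mulrA ler_wpM2l// mulrDl; apply: le_trans (ler_normD _ _) _.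
  apply: lerD; first exact: HCU.
  apply: conv_remainder; [exact: mdf|exact: tame_partial|].
  by move=> y; exact: HCK.
- move=> s x k l; rewrite /H.
  have -> : partial l (partial k U) x = partial k (partial l U) x.
    by apply: partialC; exact: tU.1.
  have -> // : partial l (partial k K) = partial k (partial l K).
  by apply/funext => y; apply: partialC; exact: tK.1.
- by move=> y s sT; have := flow_ode hPhi (z := y) sT; rewrite bN.
- exact: flow0 hPhi.
- exact: tT.
- by move=> y k; exact: smooth_differentiable (flow_smooth hPhi tT k).
Qed.

End mean_field_flow.

(** * Divergence and metric pulled back by a symplectic diffeomorphism *)

Section symplectic_pullback.
Context {R : realType} {d : nat}.
Local Notation phase := 'rV[R]_(d + d).
Local Notation xi k := (lshift d k).
Local Notation vi k := (rshift d k).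

Lemma Dmx_coord n k (F : 'rV[R]_n -> 'rV[R]_k) z a i :
  (forall j, differentiable (fun y => F y 0 j) z) ->
  Dmx F z a i = partial i (fun y => F y 0 a) z.
Proof.
move=> dF; have dF' := differentiable_rVP dF.
rewrite /partial -derive_rV// deriveE//.
by rewrite !mxE.
Qed.

Local Opaque partial.

(** The matrix of [omega] in the canonical basis. *)
Definition symp : 'M[R]_(d + d) := block_mx 0 1%:M (- 1%:M) 0.

Lemma mul_symp n (M : 'M[R]_(d + d, n)) :
  symp *m M = col_mx (dsubmx M) (- usubmx M).
Proof.
rewrite -[M in LHS]vsubmxK mul_block_col !mul0mx add0r mul1mx addr0.
by rewrite mulNmx mul1mx.
Qed.

Lemma mulr_symp n (M : 'M[R]_(n, d + d)) :
  M *m symp = row_mx (- rsubmx M) (lsubmx M).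
Proof.
rewrite -[M in LHS]hsubmxK mul_row_block !mulmx0 add0r addr0 mulmx1.
by rewrite mulmxN mulmx1.
Qed.

Lemma sympE (M : 'M[R]_(d + d)) i j :
  (M^T *m symp *m M) i j = omega (row i M^T) (row j M^T).
Proof.
rewrite mulr_symp; set N := M^T; have -> : M = col_mx (usubmx M) (dsubmx M).
  by rewrite vsubmxK.
rewrite mul_row_col [LHS]mxE [LHS]addrC /omega sumrB; congr (_ + _).
  by rewrite mxE; apply: eq_bigr => k _; rewrite !mxE.
by rewrite mxE -sumrN; apply: eq_bigr => k _; rewrite !mxE mulNr.
Qed.

Variables Phi Psi : phase -> phase.
Hypothesis sPhi : smooth_map Phi.
Hypothesis sPsi : smooth_map Psi.
Hypothesis PhiK : cancel Phi Psi.
Hypothesis symplectic : forall z i j,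
  omega (\row_k partial i (fun y => Phi y 0 k) z)
        (\row_k partial j (fun y => Phi y 0 k) z) =
  omega (delta_mx 0 i) (delta_mx 0 j).

Let dPhi k y : differentiable (fun y => Phi y 0 k) y.
Proof. exact: smooth_differentiable (sPhi k). Qed.

Variables A P : phase -> 'M[R]_(d + d).
Hypothesis AE : forall y, A y = Dmx Phi y.
Hypothesis PE : forall y, P y = Dmx Psi (Phi y).

Lemma jacobian_entry y a i : A y a i = partial i (fun z => Phi z 0 a) y.
Proof. by rewrite AE; exact: Dmx_coord. Qed.

Lemma inverse_jacobian_entry y i a : P y i a = partial a (fun z => Psi z 0 i)
  (Phi y).
Proof.
by rewrite PE; apply: Dmx_coord => k; exact: smooth_differentiable (sPsi k).
Qed.

(** The chain rule applied to [Psi \o Phi], which is the identity. *)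
Lemma mul_inverse_jacobian y : P y *m A y = 1%:M.
Proof.
apply/matrixP => i j; rewrite mxE [RHS]mxE.
transitivity (partial j ((fun z => Psi z 0 i) \o Phi) y).
  rewrite partial_comp//; last exact: smooth_differentiable (sPsi i).
  by apply: eq_bigr => a _; rewrite inverse_jacobian_entry jacobian_entry.
rewrite [_ \o _](_ : _ = fun y : phase => y 0 i); last first.
  by apply/funext => z /=; rewrite PhiK.
by rewrite partial_coord eq_sym.
Qed.

Lemma mul_jacobian_inverse y : A y *m P y = 1%:M.
Proof. exact: mulmx1C (mul_inverse_jacobian y). Qed.

(** Symplecticity reads [A^T symp A = symp]; multiplying by [P] on the right makes the entries of
    the inverse linear in those of [A]. *)
Lemma symp_inverse_jacobian y : symp *m P y = (A y)^T *m symp.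
Proof.
have H : (A y)^T *m symp *m A y = symp.
  apply/matrixP => i j; rewrite sympE.
  have row_A k : row k (A y)^T = \row_a partial k (fun z => Phi z 0 a) y.
    by apply/rowP => a; rewrite [LHS]mxE [LHS]mxE [RHS]mxE jacobian_entry.
  rewrite !row_A symplectic.
  by have := sympE 1%:M i j; rewrite trmx1 mul1mx mulmx1 !row1 => ->.
by rewrite -[in LHS]H -mulmxA mul_jacobian_inverse mulmx1.
Qed.

(** Only the columns [vi b] of the inverse Jacobian are computed, since the noise acts on velocities
    alone. *)
Lemma inverse_jacobian_vv y a b :
  P y (vi a) (vi b) = partial (xi a) (fun z => Phi z 0 (xi b)) y.
Proof.
have := congr1 (fun M : 'M[R]_(d + d) => M (xi a) (vi b))
  (symp_inverse_jacobian y).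
by rewrite mul_symp mulr_symp col_mxEu row_mxEr mxE [RHS]mxE [RHS]mxE
  jacobian_entry.
Qed.

Lemma inverse_jacobian_xv y a b :
  P y (xi a) (vi b) = - partial (vi a) (fun z => Phi z 0 (xi b)) y.
Proof.
have := congr1 (fun M : 'M[R]_(d + d) => M (vi a) (vi b))
  (symp_inverse_jacobian y).
rewrite mul_symp mulr_symp col_mxEd row_mxEr mxE mxE [RHS]mxE [RHS]mxE
  jacobian_entry.
by move=> <-; rewrite opprK.
Qed.

Let smooth_inverse_jacobian_v b i : smooth (fun y => P y i (vi b)).
Proof.
case: (split_ordP i) => a ->.
  rewrite (_ : (fun y => _) = fun y => -1 * partial (vi a) (fun z => Phi z 0
    (xi b)) y).
    by apply: smoothM; [exact: smooth_cst|exact: smooth_partial].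
  by apply/funext => y; rewrite inverse_jacobian_xv mulN1r.
rewrite (_ : (fun y => _) = partial (xi a) (fun z => Phi z 0 (xi b))).
  exact: smooth_partial.
by apply/funext => y; exact: inverse_jacobian_vv.
Qed.

(* The Piola identity: for a symplectic map it reduces to the symmetry of
   second derivatives. *)
Lemma inverse_jacobian_div_free b z : \sum_i partial i (fun y => P y i (vi b))
  z = 0.
Proof.
rewrite big_split_ord/= -big_split/=; apply: big1 => a _.
rewrite (_ : (fun y => P y (xi a) _) =
    fun y => - partial (vi a) (fun z => Phi z 0 (xi b)) y); last first.
  by apply/funext => y; exact: inverse_jacobian_xv.
rewrite (_ : (fun y => P y (vi a) _) =
    partial (xi a) (fun z => Phi z 0 (xi b))); last first.
  by apply/funext => y; exact: inverse_jacobian_vv.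
rewrite partialN; last exact/smooth_differentiable/smooth_partial.
by rewrite (partialC (xi a)) ?addNr.
Qed.

(** In the product rule the derivatives of [P] sum to zero because its columns are divergence free;
    in the remaining terms [A P = 1] collapses the chain rule to the velocity derivatives. *)
Lemma div_pullback (Y : 'I_d -> phase -> R) z :
  (forall b y, differentiable (Y b) y) ->
  \sum_i partial i (fun y => \sum_b P y i (vi b) * Y b (Phi y)) z =
  \sum_b partial (vi b) (Y b) (Phi z).
Proof.
move=> dY; have dYP b y : differentiable (Y b \o Phi) y.
  by apply: differentiable_comp => //; exact: differentiable_rVP.
have dP i b y : differentiable (fun y => P y i (vi b)) y.
  exact: smooth_differentiable (smooth_inverse_jacobian_v b i).
have dPY i b y : differentiable (fun y => P y i (vi b) * Y b (Phi y)) y.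
  exact: (differentiableM (f := fun y => P y i (vi b)) (g := Y b \o Phi)).
have E i : partial i (fun y => \sum_b P y i (vi b) * Y b (Phi y)) z =
    \sum_b (P z i (vi b) * (\sum_k partial k (Y b) (Phi z) * A z k i)
      + Y b (Phi z) * partial i (fun y => P y i (vi b)) z).
  rewrite partial_sumr//; apply: eq_bigr => b _.
  rewrite (partialM (h := Y b \o Phi))// partial_comp//.
  by under [in RHS]eq_bigr do rewrite jacobian_entry.
under eq_bigr do rewrite E.
rewrite exchange_big/=; apply: eq_bigr => b _.
rewrite big_split/= -mulr_sumr inverse_jacobian_div_free mulr0 addr0.
under eq_bigr do rewrite mulr_sumr.
rewrite exchange_big/= (bigD1 (vi b))//= [X in _ + X]big1 ?addr0 => [|k kb].
  transitivity (partial (vi b) (Y b) (Phi z) * (A z *m P z) (vi b) (vi b)).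
    rewrite mxE mulr_sumr; apply: eq_bigr => i _.
    by ring.
  by rewrite mul_jacobian_inverse mxE eqxx mulr1.
transitivity (partial k (Y b) (Phi z) * (A z *m P z) k (vi b)).
  rewrite mxE mulr_sumr; apply: eq_bigr => i _.
  by ring.
by rewrite mul_jacobian_inverse mxE (negPf kb) mulr0.
Qed.

(* [grad (g o Phi) = (D Phi)^T (grad g o Phi)] and [D Phi (D Psi o Phi) = 1],
   so only the [v]-derivatives of [g] survive. *)
Lemma pullback_metric_grad (s : R) (g : phase -> R) y i :
  (forall z, differentiable g z) ->
  let Gt := P y *m col_mx 0 s%:M in
  mxact (2^-1 *: (Gt *m Gt^T)) (grad (g \o Phi) y) 0 i =
  \sum_b P y i (vi b) * (s ^+ 2 / 2 * partial (vi b) g (Phi y)).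
Proof.
move=> dg Gt.
have gE : (grad (g \o Phi) y)^T = (A y)^T *m (grad g (Phi y))^T.
  apply/matrixP => k l; rewrite [LHS]mxE [LHS]mxE [RHS]mxE partial_comp//.
  apply: eq_bigr => a _; rewrite [in RHS]mxE [in RHS]mxE [in RHS]mxE.
  by rewrite jacobian_entry mulrC.
(* This is the transpose of [A P G = G], where [G] is the constant noise matrix. *)
have GA : Gt^T *m (A y)^T = (col_mx 0 s%:M)^T.
  by rewrite -trmx_mul /Gt mulmxA mul_jacobian_inverse mul1mx.
rewrite /mxact -scalemxAl gE -!mulmxA [in X in _ *: X](mulmxA _ (A y)^T) GA.
rewrite tr_col_mx trmx0 tr_scalar_mx.
rewrite -[(grad g _)^T]vsubmxK mul_row_col mul0mx add0r mul_col_mx mul0mx.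
rewrite !mul_scalar_mx [LHS]mxE [LHS]mxE [X in _ * X]mxE big_split_ord/=.
rewrite big1 ?add0r => [|k _]; last by rewrite col_mxEu mxE mulr0.
rewrite mulr_sumr; apply: eq_bigr => b _.
rewrite col_mxEd !scalerA [X in _ * (_ * X)]mxE [dsubmx _ _ _]mxE [X in _ * (_
  * (_ * X))]mxE.
by rewrite [X in _ * (_ * (_ * X))]mxE; field.
Qed.

End symplectic_pullback.

Local Opaque partial.

(** * Chain rule along a trajectory *)

Section time_derivative_along.
Context {R : realType}.
Variable T : R.

Lemma has_dt_cvg n (Z : R -> 'rV[R]_n) t b : has_dt T Z t b ->
  Z s @[s --> within `[0, T] t^'] --> Z t.
Proof.
move=> Zb; apply/cvgrPdist_le => e e0.
have [r r0 H] := (near_time_within _ _ _).1 ((cvgrPdist_le _ _).1 Zb 1 ltr01).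
have L0 : 0 < `|b| + 1 by rewrite ltr_wpDl.
apply/near_time_within; exists (Num.min r (e / (`|b| + 1))).
  by rewrite lt_min r0 divr_gt0.
move=> s; rewrite lt_min => /andP[ts tse] st sT.
have := H s ts st sT; set q := (s - t)^-1 *: (Z s - Z t) => bq.
have -> : Z t - Z s = (t - s) *: q.
  rewrite /q scalerA -opprB -[t - s]opprB mulNr mulfV ?scaleN1r//.
  by rewrite subr_eq0.
rewrite normrZ; apply: (@le_trans _ _ (`|t - s| * (`|b| + 1))).
  rewrite ler_wpM2l// -[q](subKr b); apply: le_trans (ler_normB _ _) _.
  by rewrite lerD2l.
by move: tse; rewrite ltr_pdivlMr// => /ltW.
Qed.

(** The increment splits into a spatial one at time [s], treated by the mean value theorem, and a
    temporal one at the fixed point [Z t]. Joint continuity of the spatial derivatives suffices to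
    pass to the limit. *)
Lemma has_dt_along n (f : R -> 'rV[R]_n -> R) (Z : R -> 'rV[R]_n) t b l :
  0 < t <= T -> has_dt T Z t b ->
  has_dt T (fun s => f s (Z t) : R^o) t l ->
  (forall s z, 0 < s <= T -> differentiable (f s) z) ->
  (forall i, {within [set p : R * 'rV[R]_n | 0 < p.1 <= T],
    continuous (fun p => partial i (f p.1) p.2)}) ->
  has_dt T (fun s => f s (Z s) : R^o) t
    (\sum_i b 0 i * partial i (f t) (Z t) + l).
Proof.
move=> /andP[t0 tT] Zb fl df cf.
(* [w s] is the intermediate point between [Z t] and [Z s]; outside the time interval it takes the
   dummy value [0]. *)
have /choice[w Hw] : forall s, exists w, 0 < s <= T ->
    `|Z t - w| <= `|Z t - Z s| /\
    f s (Z s) - f s (Z t) = \sum_i (Z s - Z t) 0 i * partial i (f s) w.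
  move=> s; have [sT|_] := boolP (0 < s <= T); last by exists 0.
  have [c /itvP c01] := MVT_line (Z t) (Z s - Z t) (fun y => df s y sT).
  rewrite [Z t + (_ - _)]addrC subrK => E;
    exists (Z t + c *: (Z s - Z t)) => _; split=> //.
  rewrite opprD addrA subrr add0r normrN normrZ (distrC (Z t) (Z s)).
  by rewrite ler_piMl// ger0_norm c01.
have cw i : partial i (f s) (w s) @[s --> within `[0, T] t^'] -->
    partial i (f t) (Z t).
  apply/cvgrPdist_le => e e0.
  have /subspace_continuousP/(_ (t, Z t)) /= := cf i.
  rewrite t0 tT => /(_ isT) /cvgrPdist_le/(_ e e0) [[U V] /= [Ut Vt] UV].
  have [r1 /= r10 B1] := (nbhs_ballP _ _).1 Ut.
  have [r2 /= r20 B2] := (nbhs_ballP _ _).1 Vt.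
  have [r3 r30 B3] := (near_time_within _ _ _).1
    ((cvgrPdist_lt _ _).1 (has_dt_cvg Zb) r2 r20).
  (* The bound by [t] keeps [s] positive, inside the domain where [f] is differentiable and its
     derivatives are jointly continuous. *)
  apply/near_time_within; exists (Num.min r1 (Num.min r3 t)).
    by rewrite !lt_min r10 r30.
  move=> s; rewrite !lt_min => /and3P[sr1 sr3 st] ns sT.
  have s0 : 0 < s <= T.
    have /andP[_ ->] := sT; rewrite andbT.
    by move: st; rewrite ltr_norml => /andP[_]; rewrite ltrBlDl -ltrBlDr subrr.
  apply: (UV (s, w s)) => //=; split; first by apply: B1; rewrite -ball_normE.
  apply: B2; rewrite -ball_normE/=.
  exact: le_lt_trans (Hw s s0).1 (B3 s sr3 ns sT).
have lim : (fun s => \sum_i ((s - t)^-1 * (Z s 0 i - Z t 0 i)) * partial i (f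
  s) (w s)
      + (s - t)^-1 *: (f s (Z t) - f t (Z t) : R^o))
    @ within `[0, T] t^' --> \sum_i b 0 i * partial i (f t) (Z t) + l.
  apply: cvgD => //; apply: (@cvg_big R^o 'I_n +%R 0 xpredT) => [|i _].
    exact: add_continuous.
  by apply: cvgM (cw i); exact: (has_dt_coord (i := i) Zb).
apply: cvg_trans lim; apply: near_eq_cvg.
apply/near_time_within; exists t => // s st ns sT.
have s0 : 0 < s <= T.
  have /andP[_ ->] := sT; rewrite andbT.
  by move: st; rewrite ltr_norml => /andP[_]; rewrite ltrBlDl -ltrBlDr subrr.
have [_ E] := Hw s s0.
have -> : f s (Z s) - f t (Z t) =
  (f s (Z s) - f s (Z t)) + (f s (Z t) - f t (Z t)) by rewrite subrKA.
rewrite E -[RHS]/((s - t)^-1 * (_ + _)) mulrDr mulr_sumr /=.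
congr (_ + _); apply: eq_bigr => i _.
by rewrite !mxE mulrA.
Qed.

End time_derivative_along.

(** * The Hamiltonian and its velocity derivatives *)

Section hamiltonian.
Context {R : realType} {d : nat}.
Local Notation phase := 'rV[R]_(d + d).

(* [hfun] is the case [c = m^-1], [hcheck] the case [c = (2 * m)^-1]. *)
Definition energy (m c : R) (U K : 'rV[R]_d -> R) (f : phase -> R) (z : phase)
  : R :=
  2^-1 * enorm (rsubmx z) ^+ 2 + m^-1 * U (lsubmx z) + c * conv K f (lsubmx z).

Lemma smooth_energy m c U K f : tame U -> tame K -> moment_density f ->
  smooth (energy m c U K f).
Proof.
move=> tU tK mdf; apply: smoothD; first apply: smoothD.
- apply: smoothM; first exact: smooth_cst.
  by apply: (smooth_rsubmx (g := fun a => enorm a ^+ 2));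
    exact: smooth_enorm_sqr.
- by apply: smoothM; [exact: smooth_cst|apply: smooth_lsubmx; exact: tU.1].
- by apply: smoothM; [exact: smooth_cst|apply: smooth_lsubmx;
  exact: smooth_conv].
Qed.

Lemma partial_v_lsubmx (g : 'rV[R]_d -> R) (b : 'I_d) (y : phase) : smooth g ->
  partial (rshift d b) (fun z => g (lsubmx z)) y = 0.
Proof.
move=> sg; have dl j : differentiable (fun z : phase => lsubmx z 0 j) y.
  by apply: smooth_differentiable; exact: smooth_map_lsubmx.
rewrite (partial_comp (F := lsubmx))//; last exact: smooth_differentiable.
apply: big1 => j _; rewrite (_ : (fun z : phase => lsubmx z 0 j) =
    fun z => z 0 (lshift d j)); last by apply/funext => z; rewrite mxE.
by rewrite partial_coord eq_rlshift mulr0.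
Qed.

Lemma partial_v_kinetic (b : 'I_d) (y : phase) :
  partial (rshift d b) (fun z => enorm (rsubmx z) ^+ 2) y
  = 2 * y 0 (rshift d b).
Proof.
rewrite (_ : (fun z : phase => _) =
    fun z => \sum_k z 0 (rshift d k) * z 0 (rshift d k)); last first.
  by apply/funext => z; rewrite enorm_sqr; apply: eq_bigr => k _; rewrite !mxE.
have dc (k : 'I_(d + d)) : differentiable (fun z : phase => z 0 k) y.
  exact: differentiable_coord.
rewrite partial_sumr => [|k]; last first.
  exact: (differentiableM (f := fun z : phase => z 0 (rshift d k))
    (g := fun z : phase => z 0 (rshift d k))).
rewrite (bigD1 b)//= [X in _ + X]big1 => [|k kb].
  by rewrite partialM// !partial_coord eqxx !mulr1 addr0 mulr_natl.
rewrite partialM// partial_coord eq_rshift eq_sym (negPf kb).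
by rewrite !mulr0 addr0.
Qed.

(** The potential terms depend on position only, so the result is free of [c]: [hfun] and [hcheck]
    have the same velocity gradient. *)
Lemma partial_v_energy m c U K f (b : 'I_d) (y : phase) :
  tame U -> tame K -> moment_density f ->
  partial (rshift d b) (energy m c U K f) y = y 0 (rshift d b).
Proof.
move=> tU tK mdf.
have dk : differentiable (fun z : phase => enorm (rsubmx z) ^+ 2) y.
  apply: smooth_differentiable.
  by apply: (smooth_rsubmx (g := fun a => enorm a ^+ 2));
    exact: smooth_enorm_sqr.
have dU : differentiable (fun z : phase => U (lsubmx z)) y.
  by apply: smooth_differentiable; apply: smooth_lsubmx; exact: tU.1.
have dK : differentiable (fun z : phase => conv K f (lsubmx z)) y.
  by apply: smooth_differentiable; apply: smooth_lsubmx; exact: smooth_conv.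
have dZ (a : R) (g : phase -> R) : differentiable g y ->
    differentiable (fun z => a * g z) y.
  by move=> dg; exact: (differentiableZ (f := g)).
rewrite /energy partialD; last 2 first.
- by apply: (differentiableD (f := fun z : phase => 2^-1 * enorm (rsubmx z) ^+
  2)
    (g := fun z : phase => m^-1 * U (lsubmx z))); exact: dZ.
- exact: dZ.
rewrite partialD; [|exact: dZ|exact: dZ].
rewrite !partialZ// partial_v_kinetic !partial_v_lsubmx;
  first by rewrite !mulr0 !addr0 mulKf.
- exact: smooth_conv.
- exact: tU.1.
Qed.

End hamiltonian.

(** The fluctuation-dissipation relation between noise strength and friction. *)
Lemma sigma_sqr {R : realType} (m gamma beta : R) :
  0 < m -> 0 < gamma -> 0 < beta ->
  Defs.sigma m gamma beta ^+ 2 / 2 * (beta * m) = gamma / m.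
Proof.
move=> m0 g0 b0; rewrite sqr_sqrtr.
  by field; rewrite !gt_eqF.
by rewrite divr_ge0// ?mulr_ge0// ?exprn_ge0// ltW.
Qed.

(** * Dissipative flux and transport part of the kinetic equation *)

Section vlasov_fokker_planck.
Context {R : realType} {d : nat}.
Local Notation phase := 'rV[R]_(d + d).

(** For positive [f] this is [sigma^2 / 2] times [f] times the velocity gradient of
    [ln f + beta m h]; its divergence combines friction and diffusion. *)
Definition vflux (m gamma beta : R) (f : phase -> R) (b : 'I_d) (y : phase) : R
  :=
  Defs.sigma m gamma beta ^+ 2 / 2 *
  (partial (rshift d b) f y + beta * m * (f y * y 0 (rshift d b))).

Lemma smooth_vflux m gamma beta f b :
  smooth f -> smooth (vflux m gamma beta f b).
Proof.
move=> sf; apply: smoothM; first exact: smooth_cst.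
apply: smoothD; first exact: smooth_partial.
apply: smoothM; first exact: smooth_cst.
by apply: smoothM => //; exact: smooth_coord.
Qed.

Lemma sum_partial_vflux m gamma beta f y :
  0 < m -> 0 < gamma -> 0 < beta -> smooth f ->
  \sum_b partial (rshift d b) (vflux m gamma beta f b) y =
  gamma / m * divv (fun y => f y *: rsubmx y) y
  + Defs.sigma m gamma beta ^+ 2 / 2 * laplacev f y.
Proof.
move=> m0 g0 b0 sf; rewrite -(sigma_sqr m0 g0 b0).
rewrite /laplacev /divv !mulr_sumr -big_split/=; apply: eq_bigr => b _.
have -> : (fun y : phase => gradv f y 0 b) = partial (rshift d b) f.
  by apply/funext => z; rewrite !mxE.
have -> : (fun y : phase => (f y *: rsubmx y) 0 b) =
    fun y => f y * y 0 (rshift d b) by apply/funext => z; rewrite !mxE.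
have sfv : smooth (fun y : phase => f y * y 0 (rshift d b)).
  by apply: smoothM => //; exact: smooth_coord.
have sc : smooth (fun y => beta * m * (f y * y 0 (rshift d b))).
  by apply: smoothM => //; exact: smooth_cst.
rewrite partialZ; last first.
  by apply: smooth_differentiable; apply: smoothD => //; exact: smooth_partial.
rewrite partialD; [|exact/smooth_differentiable/smooth_partial
                   |exact: smooth_differentiable].
by rewrite partialZ; [ring|exact: smooth_differentiable].
Qed.

(** [bH] is the characteristic field of the transport part of the equation; [D] stands for the
    dissipative terms. *)
Lemma transport_cancel m U K (f : phase -> R) (y : phase) (D : R) :
  tame U -> tame K -> moment_density f ->
  \sum_i bH m U K f y 0 i * partial i f y +
    (- dotv (rsubmx y) (gradx f y)
     + m^-1 * dotv (grad (fun x => U x + conv K f x) (lsubmx y)) (gradv f y)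
     + D) = D.
Proof.
move=> tU tK mdf; rewrite big_split_ord/=.
have -> : \sum_i bH m U K f y 0 (lshift d i) * partial (lshift d i) f y =
    dotv (rsubmx y) (gradx f y).
  by apply: eq_bigr => k _;
    rewrite row_mxEl [gradx _ _ _ _]mxE [grad _ _ _ _]mxE.
have -> : \sum_i bH m U K f y 0 (rshift d i) * partial (rshift d i) f y =
    - (m^-1 * dotv (grad (fun x => U x + conv K f x) (lsubmx y)) (gradv f y)).
  rewrite /dotv mulr_sumr -sumrN; apply: eq_bigr => k _.
  rewrite row_mxEr [gradv _ _ _ _]mxE [grad f _ _ _]mxE [grad _ (lsubmx y) _
    _]mxE.
  rewrite partialD; last 2 first.
  - exact: smooth_differentiable tU.1.
  - by apply: smooth_differentiable; exact: smooth_conv.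
  rewrite (partial_conv mdf)// !mxE.
  by move: (partial _ U _) (conv _ _ _) (partial _ f y) => p q r; ring.
by move: (dotv _ _) (m^-1 * dotv _ _) => p q; ring.
Qed.

End vlasov_fokker_planck.

(** * Divergence form of the pulled-back dissipation *)

Section pulled_back_gradient.
Context {R : realType} {d : nat}.
Local Notation phase := 'rV[R]_(d + d).

(** Only the velocity derivatives of [phi] are prescribed, so the identity serves both the first
    variation and the potential with the full mean-field energy. *)
Lemma pulled_back_divergence (m gamma beta t : R) (Phi Phiinv : R -> phase ->
  phase)
    (f phi : phase -> R) z :
  smooth_map (Phi t) -> smooth_map (Phiinv t) -> cancel (Phi t) (Phiinv t) ->
  (forall z i j,
    omega (\row_k partial i (fun y => Phi t y 0 k) z)
          (\row_k partial j (fun y => Phi t y 0 k) z) =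
    omega (delta_mx 0 i) (delta_mx 0 j)) ->
  smooth f -> (forall y, 0 < f y) -> (forall y, differentiable phi y) ->
  (forall y b, partial (rshift d b) phi y =
    (f y)^-1 * partial (rshift d b) f y + beta * m * y 0 (rshift d b)) ->
  Defs.div (fun y => (f \o Phi t) y *:
    mxact (Jmx m gamma beta Phi Phiinv t y) (grad (phi \o Phi t) y)) z =
  \sum_b partial (rshift d b) (vflux m gamma beta f b) (Phi t z).
Proof.
move=> sPhi sPsi PhiK sympl sf f0 dphi phiE.
pose P y := Dmx (Phiinv t) (Phi t y).
have dY b y : differentiable (vflux m gamma beta f b) y.
  by apply: smooth_differentiable; exact: smooth_vflux.
rewrite -(div_pullback sPhi sPsi PhiK sympl
  (A := fun y => Dmx (Phi t) y) (P := P) _ _ z dY)//.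
apply: eq_bigr => i _; congr (partial i _ z); apply/funext => y.
rewrite mxE (pullback_metric_grad sPhi sPsi PhiK
  (A := fun y => Dmx (Phi t) y) (P := P))// mulr_sumr.
apply: eq_bigr => b _; rewrite phiE /vflux /=.
by field; rewrite gt_eqF.
Qed.

End pulled_back_gradient.

Theorem theorem3p9 (R : realType) (d : nat) (hd : (1 <= d)%N)
  (T m gamma beta : R) (hT : 0 < T) (hm : 0 < m) (hgamma : 0 < gamma)
  (hbeta : 0 < beta)
  (U K : 'rV[R]_d -> R) (hUK : regular_potentials U K)
  (dO : measure_display) (Om : measurableType dO) (P : probability Om R)
  (Fi : R -> set (set Om)) (hFi : normal_filtration P Fi)
  (B X V : R -> Om -> 'rV[R]_d) (hB : brownian P Fi B)
  (hXV : langevin_solution P m gamma beta U K T Fi B X V)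
  (f : R -> 'rV[R]_(d + d) -> R)
  (hf0 : regular_initial P m beta U K X V (f 0))
  (hf : smooth_density P T X V f)
  (hVFP : VFP m gamma beta U K T f)
  (Phi Phiinv : R -> 'rV[R]_(d + d) -> 'rV[R]_(d + d))
  (hPhi : is_flow T (fun t => bH m U K (f t)) Phi Phiinv)
  (hfin : forall t : R, 0 < t <= T ->
    free_energy_pb m beta U K f Phi t (pullback f Phi t) \is a fin_num) :
  let u := pullback f Phi in
  let J := Jmx m gamma beta Phi Phiinv in
  forall t : R, 0 < t <= T ->
  let xi := fun z => ln (u t z) + beta * m * hfun m U K (f t) (Phi t z) in
  exists g : 'rV[R]_(d + d) -> R,
    [/\ is_WJ_gradient (J t) (free_energy_pb m beta U K f Phi t) (u t) g,
        forall z, has_dt T (fun s => u s z : R^o) t (- g z),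
        forall z, - g z =
          div (fun y => u t y *: mxact (J t y) (grad xi y)) z
      & forall z, - g z = - onsager (J t) (u t) xi z].
Proof.
move=> u J t tT xi.
have tT' : 0 <= t <= T by case/andP: tT => /ltW -> ->.
have tU : tame U by apply: bounded_partials;
  [exact: U_smooth hUK|exact: U_bounded hUK].
have tK : tame K by apply: bounded_partials;
  [exact: K_smooth hUK|exact: K_bounded hUK].
have mdf s : 0 <= s <= T -> moment_density (f s).
  exact: langevin_moment_density hFi hXV hf.
have mdt := mdf t tT'.
have sympl := mean_field_symplectic tU tK mdf hPhi.
have sf : smooth (f t) by apply: (dens_smooth hf).
have f0 y : 0 < f t y by apply: (dens_gt0 hf).
have sPhi : smooth_map (Phi t) by apply: (flow_smooth hPhi).
have sPsi : smooth_map (Phiinv t) by apply: (flowV_smooth hPhi).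
have PhiK : cancel (Phi t) (Phiinv t) by apply: (flowK hPhi).
(* One family covers both potentials before pull-back: [a = 1] and [c = (2 * m)^-1] give the first
   variation, [a = 0] and [c = m^-1] give [xi]. *)
pose phi (a c : R) y := ln (f t y) + (a + beta * m * energy m c U K (f t) y).
have sln : smooth (fun y => ln (f t y)) by exact: smooth_ln.
have sE c : smooth (energy m c U K (f t)) by exact: smooth_energy.
have sE' a c : smooth (fun y => a + beta * m * energy m c U K (f t) y).
  apply: smoothD; first exact: smooth_cst.
  by apply: smoothM => //; exact: smooth_cst.
have sphi a c : smooth (phi a c) by exact: smoothD.
have phiE a c y b : partial (rshift d b) (phi a c) y =
    (f t y)^-1 * partial (rshift d b) (f t) y + beta * m * y 0 (rshift d b).
  rewrite partialD; [|exact: smooth_differentiable|exact: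
    smooth_differentiable].
  rewrite partialD; [|exact: differentiable_cst|]; last first.
    by apply: smooth_differentiable; apply: smoothM => //; exact: smooth_cst.
  rewrite partial_cst add0r partialZ; last exact: smooth_differentiable.
  rewrite partial_v_energy//; congr (_ + _).
  by apply: (@partial_comp1 _ _ (@ln R) (f t));
    [exact: is_derive1_ln|exact: smooth_differentiable].
have divE a c z :
    Defs.div (fun y => u t y *: mxact (J t y) (grad (phi a c \o Phi t) y)) z =
    \sum_b partial (rshift d b) (vflux m gamma beta (f t) b) (Phi t z).
  apply: pulled_back_divergence => //; first by move=> y i j; exact: sympl.
  by move=> y; exact: smooth_differentiable.
pose psi := phi 1 (2 * m)^-1 \o Phi t.
have xiE : xi = phi 0 m^-1 \o Phi t.
  by apply/funext => z; rewrite /xi /phi/= add0r.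
(* By [divE] the divergence depends on neither [a] nor [c], so replacing [hcheck] by [hfun] and
   dropping the constant 1 leave it unchanged. *)
have div_xi z : Defs.div (fun y => u t y *: mxact (J t y) (grad psi y)) z =
    Defs.div (fun y => u t y *: mxact (J t y) (grad xi y)) z.
  by rewrite divE xiE divE.
exists (fun z => - Defs.div (fun y => u t y *: mxact (J t y) (grad psi y)) z);
  split.
- exists psi; split=> //; first exact: smooth_comp.
  have -> : psi = fun z => ln (u t z) + 1
      + beta * m * hcheck m U K (f t) (Phi t z).
    by apply/funext => z; rewrite /psi /phi/= addrA.
  apply: (entropy_first_variation
    (H := fun z => hcheck m U K (f t) (Phi t z)) (c := beta * m)).
  + by apply: smooth_continuous; exact: smooth_comp.
  + by move=> z; exact: f0.
  + by apply: smooth_continuous; exact: (smooth_comp (sE (2 * m)^-1) sPhi).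
  + exact: hfin.
- move=> z; rewrite opprK divE sum_partial_vflux//.
  (* The trajectory starts at [z], and the partial time derivative at the fixed point [Phi t z] is
     given by the Vlasov-Fokker-Planck equation. *)
  have := has_dt_along tT (flow_ode hPhi (z := z) tT') (hVFP t (Phi t z) tT).
  rewrite -addrA transport_cancel//; apply.
  + move=> s y /andP[s0 sT].
    by apply: smooth_differentiable; apply: dens_smooth hf _ _; rewrite ltW.
  + by move=> i; exact: dens_continuous hf [:: i].
- by move=> z; rewrite opprK; exact: div_xi.
- by move=> z; rewrite div_xi; exact: erefl.
Qed.
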